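(* Let $n=2k+1$ be odd, with $k\ge 1$ an integer. A function $g\in C^\infty(\mathbb{R}^{2k}\times\mathbb{R})$ is in the range of the restricted conical Radon transform $\mathcal{C}$ on $C_0^\infty(\mathbb{R}^{2k}\times\mathbb{R})$ (i.e. $g=\mathcal{C}[f]$ for some $f\in C_0^\infty(\mathbb{R}^{2k}\times\mathbb{R})$) if and only if the following conditions are satisfied: (i) $\square^{2k}\mathcal{C}^{1}[g](\boldsymbol{x},t)$ has compact support. (ii) $\int_{-\infty}^{\infty}\square^{2k}\mathcal{C}^{1}[g](\boldsymbol{x},t)\,dt=0$ for every $\boldsymbol{x}\in\mathbb{R}^{2k}$. (iii) $\operatorname{supp} g\subseteq H_{t_0}$ for some $t_0\in\mathbb{R}$.
   Context: Points of $\mathbb{R}^n=\mathbb{R}^{n-1}\times\mathbb{R}$ are written $(\boldsymbol{x},t)$. $C_0^\infty$ denotes smooth functions with compact support. For $t_0\in\mathbb{R}$, $H_{t_0}=\{(\boldsymbol{x},t): t\le t_0\}$. The d'Alembertian is $\square=\frac{\partial^2}{\partial t^2}-\Delta_{\boldsymbol{x}}$, where $\Delta_{\boldsymbol{x}}$ is the Laplacian in $\boldsymbol{x}\in\mathbb{R}^{n-1}$. The restricted conical Radon transform $\mathcal{C}$ (half-opening angle $\pi/4$, axis direction $\boldsymbol{e}_n=(\boldsymbol{0},1)$) is convolution with the distribution $D(\boldsymbol{x},t)=\delta(-t-|\boldsymbol{x}|)$, $\delta$ the Dirac delta, that is $$\mathcal{C}[f](\boldsymbol{x},t)=(D*f)(\boldsymbol{x},t)=\int_{\mathbb{R}^{n-1}}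 f(\boldsymbol{x}+\boldsymbol{u},\,t+|\boldsymbol{u}|)\,d\boldsymbol{u}.$$ Up to a positive constant factor this is the integral of $f$ with respect to surface measure over the cone with vertex $(\boldsymbol{x},t)$, axis direction $\boldsymbol{e}_n$ and half-opening angle $\pi/4$. The weighted transform $\mathcal{C}^1$ is convolution with $D^1(\boldsymbol{x},t)=|(\boldsymbol{x},t)|^{-1}\delta(-t-|\boldsymbol{x}|)$, that is $$\mathcal{C}^1[f](\boldsymbol{x},t)=\int_{\mathbb{R}^{n-1}} \frac{f(\boldsymbol{x}+\boldsymbol{u},\,t+|\boldsymbol{u}|)}{\sqrt2\,|\boldsymbol{u}|}\,d\boldsymbol{u}.$$ It is well defined on smooth functions supported in some $H_{t_0}$, because the integrand then has bounded support in $\boldsymbol{u}$; conditions (i) and (ii) are understood for $g$ satisfying (iii). *)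

(* Defs.v *)
From HB Require Import structures.
From mathcomp Require Import all_boot all_order all_algebra.
From mathcomp Require Import all_classical all_reals all_analysis.

Set Implicit Arguments.
Unset Strict Implicit.
Unset Printing Implicit Defensive.

Import Order.TTheory GRing.Theory Num.Theory.
Import numFieldNormedType.Exports.

Local Open Scope classical_set_scope.
Local Open Scope ring_scope.

(* Lebesgue measure on R^m, carried by m.-tuple R (whose library sigma-algebra
   is the product Borel one): lambda^0 is the Dirac mass at the unique point of
   R^0 and lambda^(m+1) is the image of lambda \x lambda^m under cons. *)
Section lebesgue_tuple.
Context {R : realType}.
Local Notation RT := (measurableTypeR R).

Definition cons_pair m (p : RT * m.-tuple RT) : m.+1.-tuple RT :=
  [tuple of p.1 :: p.2].

Definition uncons m (u : m.+1.-tuple RT) : RT * m.-tuple RT :=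
  (tnth u ord0, [tuple of behead u]).

Lemma cons_pairK m : cancel (@cons_pair m) (@uncons m).
Proof. by case=> x u; congr pair; apply/val_inj. Qed.

Lemma measurable_cons_pair m : measurable_fun setT (@cons_pair m).
Proof. exact: measurable_cons. Qed.

Lemma measurable_uncons m : measurable_fun setT (@uncons m).
Proof.
by apply: measurable_fun_pair; [exact: measurable_tnth|exact: measurable_behead].
Qed.

Section step.
Variables (m : nat) (mu : {sigma_finite_measure set (m.-tuple RT) -> \bar R}).

Definition lebesgue_cons : set (m.+1.-tuple RT) -> \bar R :=
  pushforward (@lebesgue_measure R \x mu)%E (@cons_pair m).

Let measurable_preimage_cons A : measurable A ->
  measurable (@cons_pair m @^-1` A).
Proof.
by move=> mA; rewrite -[X in measurable X]setTI; exact: measurable_cons_pair.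
Qed.

Let lebesgue_cons0 : lebesgue_cons set0 = 0%E.
Proof. by rewrite /lebesgue_cons /pushforward preimage_set0 measure0. Qed.

Let lebesgue_cons_ge0 A : (0 <= lebesgue_cons A)%E.
Proof. by rewrite /lebesgue_cons /pushforward; exact: measure_ge0. Qed.

Let lebesgue_cons_sigma_additive : semi_sigma_additive lebesgue_cons.
Proof.
move=> F mF tF mUF; rewrite /lebesgue_cons /pushforward preimage_bigcup.
apply: measure_semi_sigma_additive.
- by move=> n; exact: measurable_preimage_cons.
- apply/trivIsetP => /= i j _ _ ij; rewrite -preimage_setI.
  by move/trivIsetP : tF => /(_ _ _ _ _ ij) ->//; rewrite preimage_set0.
- by rewrite -preimage_bigcup; exact: measurable_preimage_cons.
Qed.

HB.instance Definition _ := isMeasure.Build _ _ _ lebesgue_cons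
  lebesgue_cons0 lebesgue_cons_ge0 lebesgue_cons_sigma_additive.

Lemma lebesgue_cons_sigma_finite : sigma_finite setT lebesgue_cons.
Proof.
have /sigma_finiteP[F [TF ndF Foo]] := sigma_finiteT (@lebesgue_measure R).
have /sigma_finiteP[G [TG ndG Goo]] := sigma_finiteT mu.
exists (fun i => @uncons m @^-1` (F i `*` G i)).
  rewrite -preimage_bigcup (_ : \bigcup_i _ = setT) ?preimage_setT//.
  rewrite -setXTT TF TG predeqE => -[x y]; split.
    move=> [n _ []/= ? ?]; split; exists n => //.
  move=> [/= [n _ Fnx] [k _ Gky]]; exists (maxn n k) => //; split.
  - by move: x Fnx; exact/subsetPset/ndF/leq_maxl.
  - by move: y Gky; exact/subsetPset/ndG/leq_maxr.
move=> i; have [mF Fi] := Foo i; have [mG Gi] := Goo i; split.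
  rewrite -[X in measurable X]setTI; apply: measurable_uncons => //.
  exact: measurableX.
rewrite /lebesgue_cons /pushforward -comp_preimage.
rewrite (_ : @uncons m \o @cons_pair m = id); last exact/funext/cons_pairK.
by rewrite preimage_id product_measure1E// lte_mul_pinfty// ge0_fin_numE.
Qed.

HB.instance Definition _ := Measure_isSigmaFinite.Build _ _ _ lebesgue_cons
  lebesgue_cons_sigma_finite.
End step.

Fixpoint lebesgue_tuple m : {sigma_finite_measure set (m.-tuple RT) -> \bar R} :=
  match m with
  | 0 => dirac [tuple]
  | m'.+1 => lebesgue_cons (lebesgue_tuple m')
  end.
End lebesgue_tuple.

Section conical_radon.
Context {R : realType} {m : nat}.

(* Points (x, t) of R^m x R. *)
Local Notation spacetime := ('rV[R]_m * R)%type.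

Implicit Types (f : spacetime -> R) (p : spacetime) (x u : 'rV[R]_m) (t : R).

(* The norm of 'rV[R]_m provided by the library is the sup norm. *)
Definition eucl_norm x : R := Num.sqrt (\sum_(i < m) x ord0 i ^+ 2).

(* [Some i] is the i-th space direction and [None] the time direction. *)
Definition axis (j : option 'I_m) : spacetime :=
  if j is Some i then (delta_mx ord0 i, 0) else (0, 1).

Definition partial j f : spacetime -> R := fun p => 'D_(axis j) f p.

Definition smooth f : Prop :=
  forall s : seq (option 'I_m),
    continuous (foldr partial f s) /\
    forall j p, derivable (foldr partial f s) p (axis j).

Definition supp f : set spacetime := closure [set p | f p != 0].

Definition compactly_supported f : Prop := compact (supp f).

Definition past t0 : set spacetime := [set p | p.2 <= t0].

Definition dalembertian f : spacetime -> R := fun p =>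
  partial None (partial None f) p -
  \sum_(i < m) partial (Some i) (partial (Some i) f) p.

Definition row_of_tuple (u : m.-tuple R) : 'rV[R]_m := \row_i tnth u i.

Definition integral_space (h : 'rV[R]_m -> R) : R :=
  \int[@lebesgue_tuple R m]_u h (row_of_tuple u).

Definition conical f : spacetime -> R := fun p =>
  integral_space (fun u => f (p.1 + u, p.2 + eucl_norm u)).

Definition conical1 f : spacetime -> R := fun p =>
  integral_space (fun u =>
    f (p.1 + u, p.2 + eucl_norm u) / (Num.sqrt 2 * eucl_norm u)).

End conical_radon.

(* Main.v *)
(** Let [m >= 2], let [B0], [B1], [R_i] be the cone transforms with weights
    [1], [1/|u|], [u_i/|u|], acting on smooth functions that vanish for large
    [t], and write [D_i] for the partial derivatives.  Translating the variable
    of integration gives [B0 D_i + R_i D_t = 0], dilating it gives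
    [\sum_i R_i D_i + B0 D_t = (1 - m) B1]; as [D_t] is injective, it follows
    that [box B0 = (1 - m) D_t B1] and [box R_i = (m - 1) D_i B1].  By these
    relations [P = box^(m-1) B1 B1] commutes with multiplication by [x_i - c].
    By Hadamard's lemma [w - w(x0, _)] is a sum of multiples of the
    [x_i - x0_i], so [P w (x0, t)] only depends on [w (x0, _)]; on functions of
    [t] alone everything is a one-dimensional integral, and [P] turns out to be
    a nonzero multiple of the identity.  Hence [box^m B1 B0 = c D_t] with
    [c <> 0], for [m] odd as well as even.  Thus [box^m B1 g] is a multiple of
    [D_t f] when [g = B0 f].  Conversely (ii) makes the antiderivative [f] in
    [t] of [box^m B1 g / c] compactly supported, and [w = B0 f - g] satisfies
    [box^m B1 w = 0]; applying [B0] gives [D_t w = 0], so [w = 0]. *)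

(* The argument uses neither Fourier transform nor fundamental solutions. The kernels are singular
   at the apex, so they are never differentiated: derivatives always fall on the function, and
   integration by parts against a kernel is replaced by the invariance of Lebesgue measure under
   translations and dilations.

   Compact support in space is given up throughout, because freezing the space variable produces
   functions of [t] alone. The class [past_smooth] asks only for smoothness and vanishing for large
   [t]; at each point a bounded piece of the cone then contributes, so all integrals converge. The
   assumption [m >= 2] makes [1/|u|] locally integrable and [1 - m] nonzero.

   That [P] commutes with the space coordinates removes the dependence on neighbouring points. What
   remains is decided on functions of [t], where [B1] is reduced to [B0] and [B0] is computed from
   the volume [V] of the unit ball, without polar coordinates. The outcome is
   [c = (V m!)^2 / (1 - m)]. *)
Require Import Defs.
From HB Require Import structures.
From mathcomp Require Import all_boot all_order all_algebra.
From mathcomp Require Import all_classical all_reals all_analysis.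
From mathcomp Require Import measurable_realfun ring lra.

Set Implicit Arguments.
Unset Strict Implicit.
Unset Printing Implicit Defensive.

Import Order.TTheory GRing.Theory Num.Theory.
Import numFieldNormedType.Exports.

Local Open Scope classical_set_scope.
Local Open Scope ring_scope.

(** * Calculus on spacetime *)

Section spacetime_calculus.
Context {R : realType} {m : nat}.
Local Notation spacetime := ('rV[R]_m * R)%type.
Implicit Types (f g w : spacetime -> R) (p q v : spacetime).

Definition stcoord (j : option 'I_m) p : R :=
  if j is Some i then p.1 ord0 i else p.2.

Lemma stcoordD j p q : stcoord j (p + q) = stcoord j p + stcoord j q.
Proof. by case: j => [i|] //=; rewrite mxE. Qed.

Lemma stcoordB j p q : stcoord j (p - q) = stcoord j p - stcoord j q.
Proof. by case: j => [i|] //=; rewrite !mxE. Qed.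

Lemma stcoordZ j a p : stcoord j (a *: p) = a * stcoord j p.
Proof. by case: j => [i|] //=; rewrite mxE. Qed.

Lemma stcoord_axis i j : stcoord i (axis j) = (i == j)%:R.
Proof.
by case: i => [i|]; case: j => [j|] //=; rewrite ?mxE ?eqxx.
Qed.

Lemma stcoordP p q : (forall j, stcoord j p = stcoord j q) -> p = q.
Proof.
case: p q => [x t] [y s] pq; congr pair; last exact: (pq None).
by apply/rowP => i; exact: (pq (Some i)).
Qed.

Lemma stcoord_sum (I : Type) (r : seq I) (F : I -> spacetime) j :
  stcoord j (\sum_(i <- r) F i) = \sum_(i <- r) stcoord j (F i).
Proof.
elim: r => [|i r IH]; last by rewrite !big_cons stcoordD IH.
by rewrite !big_nil; case: j => [i|] //=; rewrite mxE.
Qed.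

Lemma spacetimeE p : p = \sum_j stcoord j p *: axis j.
Proof.
apply: stcoordP => i; rewrite stcoord_sum (bigD1 i) //= stcoordZ stcoord_axis eqxx.
rewrite mulr1 big1 ?addr0 // => j ji.
by rewrite stcoordZ stcoord_axis eq_sym (negbTE ji) mulr0.
Qed.

Lemma stcoord_continuous j : continuous (stcoord j).
Proof.
case: j => [i|] p.
  apply: (@continuous_comp _ _ _ fst (fun x : 'rV[R]_m => x ord0 i)).
    exact: cvg_fst.
  exact: coord_continuous.
exact: cvg_snd.
Qed.

Lemma rV_norm_le n (x : 'rV[R]_n) (M : R) :
  0 <= M -> (forall i, `|x ord0 i| <= M) -> `|x| <= M.
Proof.
move=> M0 xM; rewrite [leLHS]/Num.norm /= mx_normrE.
by apply/bigmax_leP; split => // -[i j] _ /=; rewrite ord1.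
Qed.

Lemma rV_coord_le n (x : 'rV[R]_n) i : `|x ord0 i| <= `|x|.
Proof.
rewrite [leRHS]/Num.norm /= mx_normrE.
by apply/bigmax_geP; right => /=; exists (ord0, i).
Qed.

Lemma norm_le p (M : R) : (`|p| <= M) = (`|p.1| <= M) && (`|p.2| <= M).
Proof. by rewrite prod_normE ge_max. Qed.

Lemma stcoord_norm j p : `|stcoord j p| <= `|p|.
Proof.
have := lexx `|p|; rewrite {1}norm_le => /andP[p1 p2].
by case: j => [i|] //=; apply: le_trans p1; exact: rV_coord_le.
Qed.

Lemma cvg_rsum (T : Type) (F : set_system T) {FF : Filter F} (I : Type) (r : seq I)
    (u : I -> T -> R) (l : I -> R) :
  (forall i, u i x @[x --> F] --> l i) ->
  \sum_(i <- r) u i x @[x --> F] --> \sum_(i <- r) l i.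
Proof.
move=> ul; elim: r => [|i r IH].
  by rewrite big_nil; under eq_fun do rewrite big_nil; exact: cvg_cst.
by rewrite big_cons; under eq_fun do rewrite big_cons; exact: cvgD.
Qed.

Lemma norm_axis (j : option 'I_m) : `|axis j : spacetime| <= 1 :> R.
Proof.
rewrite norm_le; case: j => [i|]; rewrite /= ?normr0 ?normr1 ler01 ?lexx //.
rewrite andbT; apply: rV_norm_le => // k.
by rewrite mxE eqxx /=; case: (_ == _); rewrite ?normr1 ?normr0.
Qed.

(** [smooth] speaks only of derivatives along the axes. Their continuity is what yields the
    first-order expansion of [caratheodory] and through it the chain rule. *)
Definition c1 f := forall j,
  (forall p, derivable f p (axis j)) /\ continuous (partial j f).

Lemma partialE f j p : partial j f p = 'D_(axis j) f p.
Proof. by []. Qed.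

Lemma line_is_derive f p v (s d : R) : is_derive (p + s *: v) v f d ->
  is_derive s 1 (fun s : R => f (p + s *: v)) d.
Proof.
case=> df <-; have E : (fun h : R => h^-1 *:
    (((fun s : R => f (p + s *: v)) \o shift s) (h *: 1) - f (p + s *: v))) =
    (fun h => h^-1 *: ((f \o shift (p + s *: v)) (h *: v) - f (p + s *: v))).
  apply/funext => h /=; congr (_ *: (f _ - _)).
  by rewrite [h *: 1]mulr1 scalerDl addrCA.
by apply: DeriveDef; rewrite /derivable /derive E.
Qed.

Lemma axis_mvt f j p (h : R) : (forall p, derivable f p (axis j)) ->
  exists2 c : R, `|c| <= `|h| &
    f (p + h *: axis j) - f p = h * partial j f (p + c *: axis j).
Proof.
move=> df; pose g s := f (p + s *: axis j).
have dg (s : R) : is_derive s 1 g (partial j f (p + s *: axis j)).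
  by apply: line_is_derive; rewrite partialE; exact: derivableP.
have cg (a b : R) : {within `[a, b], continuous g}.
  by apply: derivable_within_continuous => x _; apply: ex_derive.
have g0 : f p = g 0 by rewrite /g scale0r addr0.
have [h0|h0] := leP 0 h.
  have [c + E] := MVT_segment h0 (fun s _ => dg s) (cg _ _).
  rewrite in_itv /= => /andP[c0 ch]; exists c.
    by rewrite !ger0_norm.
  by rewrite g0 -/(g h) E subr0 mulrC.
have [c + E] := MVT_segment (ltW h0) (fun s _ => dg s) (cg _ _).
rewrite in_itv /= => /andP[ch c0]; exists c.
  by rewrite (ler0_norm c0) (ltr0_norm h0) lerN2.
by rewrite g0 -/(g h) -[LHS]opprB E sub0r mulrN opprK mulrC.
Qed.

(* Moving along one axis at a time reduces this to the mean value theorem. *)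
Lemma caratheodory f p : c1 f -> exists A : option 'I_m -> spacetime -> R,
  (forall v, f (p + v) - f p = \sum_j stcoord j v * A j v) /\
  forall j, A j v @[v --> (0 : spacetime)] --> partial j f p.
Proof.
move=> cf.
have step v (r : seq (option 'I_m)) : uniq r -> exists xi : option 'I_m -> spacetime,
    f (p + \sum_(j <- r) stcoord j v *: axis j) - f p =
      \sum_(j <- r) stcoord j v * partial j f (p + xi j) /\
    forall j, `|xi j| <= \sum_(j <- r) `|stcoord j v|.
  elim: r => [|j r IH] /=.
    by move=> _; exists (fun=> 0); rewrite !big_nil addr0 subrr normr0; split.
  move=> /andP[jr /IH[xi [E xib]]]; set S := \sum_(j <- r) stcoord j v *: axis j in E.
  have Sle : `|S| <= \sum_(j <- r) `|stcoord j v|.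
    rewrite /S (le_trans (ler_norm_sum _ _ _)) //; apply: ler_sum => i _.
    by rewrite normrZ ler_piMr // norm_axis.
  have [c ch Ec] := @axis_mvt f j (p + S) (stcoord j v) (cf j).1.
  exists (fun i => if i == j then S + c *: axis j else xi i); split.
    rewrite !big_cons eqxx (addrA p S) -Ec -/S.
    under eq_big_seq => i ir.
      have -> : (i == j) = false by apply: contraNF jr => /eqP <-.
      over.
    by rewrite -E (addrC _ S) (addrA p) [RHS]addrA subrK.
  move=> i; rewrite big_cons; case: ifP => _.
    rewrite addrC (le_trans (ler_normD _ _)) // lerD // normrZ.
    by rewrite (le_trans _ ch) // ler_piMr // norm_axis.
  by rewrite (le_trans (xib i)) // lerDr.
have /choice[xi xiP] : forall v, exists xi : option 'I_m -> spacetime,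
    f (p + v) - f p = \sum_j stcoord j v * partial j f (p + xi j) /\
    forall j, `|xi j| <= \sum_j `|stcoord j v|.
  move=> v; have [xi] := step v (index_enum _) (index_enum_uniq _).
  by rewrite -spacetimeE => ?; exists xi.
exists (fun j v => partial j f (p + xi v j)); split=> [v|j].
  by have [] := xiP v.
have [_ /(_ p) cj] := cf j.
suff L : p + xi v j @[v --> (0 : spacetime)] --> p by exact: cvg_comp L (cj).
rewrite -[X in _ --> X]addr0; apply: cvgD; first exact: cvg_cst.
apply: norm_cvg0; apply: (@squeeze_cvgr _ _ _ _ (cst 0) (fun v => \sum_j `|stcoord j v|)).
- by near=> v; rewrite /= normr_ge0; have [_ ->] := xiP v.
- exact: cvg_cst.
- have E0 : \sum_(j : option 'I_m) `|stcoord j 0| = 0 :> R.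
    by rewrite big1 // => i _; case: i => [i|]; rewrite /= ?mxE normr0.
  rewrite -[X in _ --> X]E0; apply: cvg_rsum => i.
  by apply: cvg_norm; apply: stcoord_continuous.
Unshelve. all: by end_near. Qed.

(** The factors of [caratheodory] avoid a division by the increment of the curve, which may
    vanish. *)
Lemma chain_rule f (gam : R -> spacetime) (s : R) (c : option 'I_m -> R) :
  c1 f -> (forall j, is_derive s 1 (fun s => stcoord j (gam s)) (c j)) ->
  is_derive s 1 (fun s => f (gam s)) (\sum_j c j * partial j f (gam s)).
Proof.
move=> cf dg; have [A [AE Al]] := caratheodory (gam s) cf.
pose D h := gam (h + s) - gam s.
have cD : D h @[h --> 0^'] --> (0 : spacetime).
  apply: norm_cvg0; apply: (@squeeze_cvgr _ _ _ _ (cst 0) (fun h => \sum_j `|stcoord j (D h)|)).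
  - near=> h; rewrite /= normr_ge0 [D h in leLHS]spacetimeE.
    rewrite (le_trans (ler_norm_sum _ _ _)) //; apply: ler_sum => j _.
    by rewrite normrZ ler_piMr // norm_axis.
  - exact: cvg_cst.
  - have E0 : \sum_(j : option 'I_m) `|stcoord j (D 0)| = 0.
      by rewrite big1 // => i _; rewrite /D add0r stcoordB subrr normr0.
    rewrite -[X in _ --> X]E0; apply: cvg_within_filter; apply: cvg_rsum => j; apply: cvg_norm.
    rewrite /D add0r stcoordB; under eq_fun do rewrite stcoordB.
    apply: cvgB; last exact: cvg_cst.
    have [/derivable1_diffP/differentiable_continuous + _] := dg j.
    move=> cs; have L : h + s @[h --> (0 : R)] --> s.
      by rewrite -[X in _ --> X]add0r; apply: cvgD; [exact: cvg_id|exact: cvg_cst].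
    exact: cvg_comp L cs.
suff L : (fun h : R => h^-1 *:
    (((fun s => f (gam s)) \o shift s) (h *: 1) - f (gam s))) @ 0^' -->
    \sum_j c j * partial j f (gam s).
  apply: DeriveDef; last exact: cvg_lim L.
  by apply/cvg_ex; eexists; exact: L.
rewrite (_ : (fun h : R => _) = fun h => \sum_j (h^-1 * stcoord j (D h)) * A j (D h)); last first.
  apply/funext => h /=; rewrite [h *: 1]mulr1.
  rewrite (_ : gam (h + s) = gam s + D h); last by rewrite /D [RHS]addrC subrK.
  by rewrite AE scaler_sumr; apply: eq_bigr => j _; exact: mulrA.
apply: cvg_rsum => j; apply: cvgM; last exact: cvg_comp (Al j).
have [] := dg j; rewrite /derivable /derive => /cvg_ex[l dl] <-.
rewrite (cvg_lim _ dl) //; apply: cvg_trans dl; apply: near_eq_cvg; near=> h.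
by rewrite /= [h *: 1]mulr1 /D stcoordB.
Unshelve. all: by end_near. Qed.

Lemma derivable_translate f p q v : derivable f (p + q) v -> derivable (fun p => f (p + q)) p v.
Proof. by rewrite /derivable; under eq_fun do rewrite /= addrA. Qed.

Lemma derive_translate f p q v : 'D_v (fun p => f (p + q)) p = 'D_v f (p + q).
Proof.
rewrite /derive (_ : (fun h : R => _) = (fun h => h^-1 *: ((f \o shift (p + q)) (h *: v) - f (p + q)))) //.
by apply/funext => h; rewrite /= addrA.
Qed.

(** The mean value theorem in direction [i] for the increment in direction [j], then in direction
    [j] for the derivative. The point found lies near [p] whatever the sign of [h]. *)
Lemma second_difference f i j p (h : R) :
  (forall p, derivable f p (axis i)) ->
  (forall p, derivable (partial i f) p (axis j)) ->
  exists2 xi : spacetime, `|xi| <= `|h| + `|h| &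
    f (p + h *: axis i + h *: axis j) - f (p + h *: axis i)
      - f (p + h *: axis j) + f p = h * (h * partial j (partial i f) (p + xi)).
Proof.
move=> di dij; pose F q := f (q + h *: axis j) - f q.
have dF q : derivable F q (axis i).
  by apply: derivableB; [exact: derivable_translate|exact: di].
have [c ch] := axis_mvt p h dF.
have -> : partial i F (p + c *: axis i) = partial i f (p + c *: axis i + h *: axis j) - partial i f (p + c *: axis i).
  rewrite partialE deriveB ?derive_translate //; exact: derivable_translate.
have [d dh ->] := axis_mvt (p + c *: axis i) h dij.
rewrite -addrA /F => E; exists (c *: axis i + d *: axis j).
  rewrite (le_trans (ler_normD _ _)) // lerD // normrZ.
    by rewrite (le_trans _ ch) // ler_piMr // norm_axis.
  by rewrite (le_trans _ dh) // ler_piMr // norm_axis.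
by rewrite (addrA p) -E; ring.
Qed.

(** The second difference is symmetric in [i] and [j], so for every [h] the two mixed derivatives
    agree at points within [2 |h|] of [p]. Continuity gives the claim as [h] tends to 0. *)
Lemma partial_comm f i j : c1 f -> c1 (partial i f) -> c1 (partial j f) ->
  partial i (partial j f) = partial j (partial i f).
Proof.
move=> cf ci cj; apply/funext => p.
have ex (h : R) : exists xi : spacetime * spacetime,
    [/\ `|xi.1| <= `|h| + `|h|, `|xi.2| <= `|h| + `|h| &
     h != 0 -> partial i (partial j f) (p + xi.1) = partial j (partial i f) (p + xi.2)].
  have [x xh Ex] := second_difference p h (cf j).1 (cj i).1.
  have [y yh Ey] := second_difference p h (cf i).1 (ci j).1.
  exists (x, y); split; [exact: xh|exact: yh|move=> h0 /=].
  have E : h * (h * partial i (partial j f) (p + x)) = h * (h * partial j (partial i f) (p + y)).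
    apply: etrans (esym Ex) (etrans _ Ey).
    by rewrite [p + h *: axis j + _]addrAC [X in X + f p]addrAC.
  exact: (mulfI h0 (mulfI h0 E)).
have /choice[xi xiP] := ex.
have lim0 (x : R -> spacetime) (F : spacetime -> R) : continuous F ->
    (forall h, `|x h| <= `|h| + `|h|) -> F (p + x h) @[h --> 0^'] --> F p.
  move=> cF xh; suff L : p + x h @[h --> 0^'] --> p by exact: cvg_comp L (cF p).
  rewrite -[X in _ --> X]addr0; apply: cvgD; first exact: cvg_cst.
  apply: norm_cvg0; apply: (@squeeze_cvgr _ _ _ _ (cst 0) (fun h => `|h| + `|h|)).
  - by near=> h; rewrite /= normr_ge0 xh.
  - exact: cvg_cst.
  - have N : `|h| @[h --> (0 : R)^'] --> `|0 : R|.
      by apply: cvg_norm; apply: cvg_within_filter; exact: cvg_id.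
    by have := cvgD N N; rewrite normr0 addr0; exact.
have L1 := lim0 (fun h => (xi h).1) _ (cj i).2 (fun h => let: And3 a _ _ := xiP h in a).
have L2 := lim0 (fun h => (xi h).2) _ (ci j).2 (fun h => let: And3 _ a _ := xiP h in a).
have L : partial j (partial i f) (p + (xi h).2) @[h --> 0^'] --> partial i (partial j f) p.
  apply: cvg_trans L1; apply: near_eq_cvg; near=> h; have [_ _ -> //] := xiP h.
  by near: h; exact: nbhs_dnbhs_neq.
exact: (cvg_unique (@Rhausdorff R) L L2).
Unshelve. all: by end_near. Qed.

End spacetime_calculus.

(* Locked copies: otherwise a failing unification unfolds the limits hidden in
   the iterated derivatives. *)
HB.lock Definition pd {R : realType} {m : nat} (j : option 'I_m)
  (f : 'rV[R]_m * R -> R) : 'rV[R]_m * R -> R := partial j f.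
HB.lock Definition box {R : realType} {m : nat}
  (f : 'rV[R]_m * R -> R) : 'rV[R]_m * R -> R := dalembertian f.
HB.lock Definition Cinf {R : realType} {m : nat}
  (f : 'rV[R]_m * R -> R) : Prop := smooth f.

(** * Algebra of smooth functions: derivatives, coordinate factors, wave operator *)

Section smooth_functions.
Context {R : realType} {m : nat}.
Local Notation spacetime := ('rV[R]_m * R)%type.
Implicit Types (f g w : spacetime -> R) (p q v : spacetime).

Lemma CinfP f : Cinf f <-> forall s : seq (option 'I_m),
  continuous (foldr pd f s) /\
  forall j p, derivable (foldr pd f s) p (axis j).
Proof. by rewrite Cinf.unlock pd.unlock. Qed.

Lemma pdE f j p : pd j f p = 'D_(axis j) f p.
Proof. by rewrite pd.unlock. Qed.

Lemma pd_val f j p (d : R) : is_derive p (axis j) f d -> pd j f p = d.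
Proof. by rewrite pdE; case. Qed.

Lemma Cinf_pd f j : Cinf f -> Cinf (pd j f).
Proof. by move=> /CinfP sf; apply/CinfP => s; have := sf (rcons s j); rewrite foldr_rcons. Qed.

Lemma Cinf_continuous f : Cinf f -> continuous f.
Proof. by move=> /CinfP /(_ [::])[]. Qed.

Lemma Cinf_derivable f p j : Cinf f -> derivable f p (axis j).
Proof. by move=> /CinfP /(_ [::])[_]; exact. Qed.

Lemma Cinf_foldr f s : Cinf f -> Cinf (foldr pd f s).
Proof. by move=> sf; elim: s => //= j s; exact: Cinf_pd. Qed.

Lemma Cinf_c1 f : Cinf f -> c1 f.
Proof.
move=> sf j; split=> [p|]; first exact: Cinf_derivable.
by have := Cinf_continuous (Cinf_pd j sf); rewrite pd.unlock.
Qed.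

Lemma pdC f i j : Cinf f -> pd i (pd j f) = pd j (pd i f).
Proof.
move=> sf; have ci k : c1 (partial k f).
  by have := Cinf_c1 (Cinf_pd k sf); rewrite pd.unlock.
by rewrite pd.unlock; apply: partial_comm => //; exact: Cinf_c1.
Qed.

Lemma pdD f g j : Cinf f -> Cinf g ->
  pd j (f + g) = pd j f + pd j g.
Proof. by move=> sf sg; apply/funext => p; rewrite !fctE !pdE deriveD //; exact: Cinf_derivable. Qed.

Lemma pdZ f (a : R) j : Cinf f -> pd j (a *: f) = a *: pd j f.
Proof. by move=> sf; apply/funext => p; rewrite !fctE !pdE deriveZ //; exact: Cinf_derivable. Qed.

Lemma pd0 j : pd j (0 : spacetime -> R) = 0.
Proof. by apply/funext => p; rewrite pdE derive_cst. Qed.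

Lemma Cinf0 : Cinf (0 : spacetime -> R).
Proof.
apply/CinfP => s; have -> : foldr pd (0 : spacetime -> R) s = 0 by elim: s => //= j s ->; exact: pd0.
by split=> [|j p]; [exact: cst_continuous|exact: derivable_cst].
Qed.

Lemma CinfD f g : Cinf f -> Cinf g -> Cinf (f + g).
Proof.
move=> /CinfP sf /CinfP sg; apply/CinfP => s; suff -> : foldr pd (f + g) s = foldr pd f s + foldr pd g s.
  have [cf df] := sf s; have [cg dg] := sg s; split=> [p|j p].
    by apply: continuousD; [exact: cf|exact: cg].
  exact: derivableD.
elim: s => [//|j s /= ->]; apply/funext => p.
by rewrite !fctE !pdE deriveD //; [have [_] := sf s|have [_] := sg s]; exact.
Qed.

Lemma CinfZ f (a : R) : Cinf f -> Cinf (a *: f).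
Proof.
move=> /CinfP sf; apply/CinfP => s; suff -> : foldr pd (a *: f) s = a *: foldr pd f s.
  have [cf df] := sf s; split=> [p|j p].
    by apply: (@continuousZl_tmp _ _ _ _ a); exact: cf.
  exact: derivableZ.
elim: s => [//|j s /= ->]; apply/funext => p.
by rewrite !fctE !pdE deriveZ //; have [_] := sf s; exact.
Qed.

Lemma Cinf_sum (I : Type) (r : seq I) (F : I -> spacetime -> R) :
  (forall i, Cinf (F i)) -> Cinf (\sum_(i <- r) F i).
Proof.
move=> sF; elim: r => [|i r IH]; first by rewrite big_nil; exact: Cinf0.
by rewrite big_cons; exact: CinfD.
Qed.

Lemma pd_sum (I : Type) (r : seq I) (F : I -> spacetime -> R) j :
  (forall i, Cinf (F i)) ->
  pd j (\sum_(i <- r) F i) = \sum_(i <- r) pd j (F i).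
Proof.
move=> sF; elim: r => [|i r IH]; first by rewrite !big_nil pd0.
by rewrite !big_cons pdD ?IH //; exact: Cinf_sum.
Qed.

(** The offset [c] will be the coordinate of the point at which an operator is evaluated, so that
    the factor vanishes there. *)
Definition mulcoord (i : option 'I_m) (c : R) f : spacetime -> R :=
  fun p => (stcoord i p - c) * f p.

Lemma mulcoordD i c f g : mulcoord i c (f + g) = mulcoord i c f + mulcoord i c g.
Proof. by apply/funext => p; exact: mulrDr. Qed.

Lemma mulcoordZ i c (a : R) f : mulcoord i c (a *: f) = a *: mulcoord i c f.
Proof. by apply/funext => p; exact: mulrCA. Qed.

Lemma mulcoord_sum i c (I : Type) (r : seq I) (F : I -> spacetime -> R) :
  mulcoord i c (\sum_(j <- r) F j) = \sum_(j <- r) mulcoord i c (F j).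
Proof.
elim: r => [|j r IH]; last by rewrite !big_cons mulcoordD IH.
by rewrite !big_nil; apply/funext => p; exact: mulr0.
Qed.

Lemma stcoord_is_derive i (c : R) j p :
  is_derive p (axis j) (fun p => stcoord i p - c) (i == j)%:R.
Proof.
have E : (fun h : R => h^-1 *:
    (((fun p => stcoord i p - c) \o shift p) (h *: axis j) - (stcoord i p - c))) @ 0^'
    --> ((i == j)%:R : R).
  apply: (@cvg_trans _ (((i == j)%:R : R) @[h --> (0 : R)^'])); last exact: cvg_cst.
  apply: near_eq_cvg; near=> h; rewrite /= stcoordD stcoordZ stcoord_axis.
  rewrite opprB addrA subrK addrK -[_ *: _]/(_ * _) mulKf //.
  by near: h; exact: nbhs_dnbhs_neq.
by apply: DeriveDef; [apply/cvg_ex; eexists; exact: E|exact: cvg_lim E].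
Unshelve. all: by end_near. Qed.

Lemma mulcoord_is_derive i c f j p : derivable f p (axis j) ->
  is_derive p (axis j) (mulcoord i c f)
    (mulcoord i c (pd j f) p + (i == j)%:R * f p).
Proof.
move=> df; have := is_deriveM (stcoord_is_derive i c j p) (derivableP df).
by rewrite /mulcoord [f p *: _]mulrC pdE; exact.
Qed.

Lemma pd_mulcoord i c f j : Cinf f ->
  pd j (mulcoord i c f) = mulcoord i c (pd j f) + (i == j)%:R *: f.
Proof.
move=> sf; apply/funext => p; apply: pd_val; apply: mulcoord_is_derive.
exact: Cinf_derivable.
Qed.

Lemma Cinf_mulcoord i c f : Cinf f -> Cinf (mulcoord i c f).
Proof.
(* The induction over the derivatives needs only the smoothness of the lower-order terms [v], not
   their form. *)
move=> sf; apply/CinfP => s; have [v sv ->] : exists2 v, Cinf v &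
    foldr pd (mulcoord i c f) s = mulcoord i c (foldr pd f s) + v.
  elim: s => [|j s [v sv /= ->]] /=.
    by exists 0; [exact: Cinf0|rewrite addr0].
  have ss := Cinf_foldr s sf.
  exists ((i == j)%:R *: foldr pd f s + pd j v).
    by apply: CinfD; [exact: CinfZ|exact: Cinf_pd].
  apply/funext => p; rewrite addrA -pd_mulcoord // fctE !pdE deriveD //; last 2 first.
  - by apply: ex_derive; apply: mulcoord_is_derive; exact: Cinf_derivable.
  - exact: Cinf_derivable.
  by rewrite -!pdE.
have ss := Cinf_foldr s sf.
split=> [p|j p].
  apply: continuousD; last exact: Cinf_continuous.
  apply: (@continuousM _ _ (fun p => stcoord i p - c)); last exact: Cinf_continuous.
  by apply: continuousB; [exact: stcoord_continuous|exact: cst_continuous].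
apply: derivableD; last exact: Cinf_derivable.
by apply: ex_derive; apply: mulcoord_is_derive; exact: Cinf_derivable.
Qed.

Lemma boxE f : box f =
  pd None (pd None f) + -1 *: \sum_(i < m) pd (Some i) (pd (Some i) f).
Proof.
by rewrite box.unlock pd.unlock; apply/funext => p; rewrite /dalembertian scaleN1r !fctE fct_sumE.
Qed.

Lemma boxD f g : Cinf f -> Cinf g ->
  box (f + g) = box f + box g.
Proof.
move=> sf sg; rewrite !boxE addrACA -scalerDr -big_split /=; congr (_ + _ *: _).
  by rewrite !pdD //; exact: Cinf_pd.
by apply: eq_bigr => i _; rewrite !pdD //; exact: Cinf_pd.
Qed.

Lemma boxZ f (a : R) : Cinf f -> box (a *: f) = a *: box f.
Proof.
move=> sf; rewrite !boxE scalerDr !scalerA mulrC -scalerA; congr (_ + _ *: _).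
  by rewrite !pdZ //; exact: Cinf_pd.
rewrite scaler_sumr.
by apply: eq_bigr => i _; rewrite !pdZ //; exact: Cinf_pd.
Qed.

Lemma box_pd f j : Cinf f ->
  box (pd j f) = pd j (box f).
Proof.
move=> sf; have sp i : Cinf (pd i f) by exact: Cinf_pd.
have C i : pd j (pd i (pd i f)) = pd i (pd i (pd j f)).
  by rewrite (pdC j i (sp i)) (pdC j i sf).
rewrite !boxE pdD; last 2 first.
- exact: Cinf_pd.
- by apply: CinfZ; apply: Cinf_sum => i; exact: Cinf_pd.
rewrite pdZ ?pd_sum => [|i|]; last 2 first.
- exact: Cinf_pd.
- by apply: Cinf_sum => i; exact: Cinf_pd.
by rewrite C; congr (_ + _ *: _); apply: eq_bigr => i _; rewrite C.
Qed.

Lemma box_mulcoord f (i : 'I_m) c : Cinf f ->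
  box (mulcoord (Some i) c f) =
  mulcoord (Some i) c (box f) + (- 2) *: pd (Some i) f.
Proof.
move=> sf; have sp k : Cinf (pd k f) by exact: Cinf_pd.
have P2 j : pd j (pd j (mulcoord (Some i) c f)) =
    mulcoord (Some i) c (pd j (pd j f)) + (2 * (Some i == j)%:R) *: pd j f.
  rewrite pd_mulcoord // pdD; [|exact: Cinf_mulcoord|exact: CinfZ].
  by rewrite pdZ // pd_mulcoord // mulrDl !mul1r scalerDl addrA.
rewrite !boxE !P2 (eq_bigr _ (fun j _ => P2 (Some j))) big_split /=.
have -> : \sum_(j < m) (2 * (Some i == Some j)%:R) *: pd (Some j) f = 2 *: pd (Some i) f.
  rewrite (bigD1 i) //= eqxx mulr1 big1 ?addr0 // => j ji.
  by rewrite (_ : (Some i == Some j) = false) ?mulr0 ?scale0r //; apply: contraNF ji => /eqP[->].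
rewrite mulr0 scale0r addr0 scalerDr addrA scalerA mulN1r; congr (_ + _).
by rewrite mulcoordD mulcoordZ mulcoord_sum.
Qed.

End smooth_functions.

Lemma measurable_forall_ord d (T : measurableType d) n (F : 'I_n -> set T) :
  (forall i, measurable (F i)) -> measurable [set x | forall i, F i x].
Proof.
move=> mF; have -> : [set x | forall i, F i x] = \bigcap_(i in setT) F i.
  by apply/seteqP; split=> [x Fx i _|x Fx i]; exact: Fx.
by apply: fin_bigcap_measurable => // i _; exact: mF.
Qed.

(** * Lebesgue measure on tuples *)

Section measurability.
Context {R : realType} {m : nat}.
Local Notation spacetime := ('rV[R]_m * R)%type.

(** Only the coordinates of [X] are known to be measurable. The preimage of an interval under [w] is
    open, hence a countable union of balls with rational centres and radii [1/(n+1)]; in the sup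
    norm each ball is a finite intersection of conditions on single coordinates. *)
Lemma measurable_continuous d (T : measurableType d) (X : T -> 'rV[R]_m) (Y : T -> R)
    (w : spacetime -> R) : (forall i, measurable_fun setT (fun y => X y ord0 i)) ->
  measurable_fun setT Y -> continuous w ->
  measurable_fun setT (fun y => w (X y, Y y)).
Proof.
move=> mX mY cw; apply: (measurability _ (RGenOpens.measurableE R)).
move=> _ [_ [a [b ->] <-]]; rewrite setTI.
set O := w @^-1` `]a, b[.
have oO : open O by move/continuousP : cw => /(_ _ (interval_open _ _)); exact.
pose c (k : 'rV[rat]_m * rat) : spacetime := (map_mx ratr k.1, ratr k.2).
(* Balls that are not contained in [O] are replaced by the empty set, so that the union runs over a
   fixed countable index. *)
pose B (k : ('rV[rat]_m * rat) * nat) : set T :=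
  if `[< ball (c k.1) k.2.+1%:R^-1 `<=` O >]
  then (fun y => (X y, Y y)) @^-1` (ball (c k.1) k.2.+1%:R^-1) else set0.
have -> : (fun y => w (X y, Y y)) @^-1` `]a, b[ = \bigcup_k B k.
  apply/seteqP; split=> [y Oy|y [k _]]; last first.
    by rewrite /B; case: asboolP => // + By; exact.
  have /nbhs_ballP[e /= e0 He] : nbhs (X y, Y y) O by apply: open_nbhs_nbhs.
  have [n ne] : exists n, n.+1%:R^-1 <= e / 2.
    have [n _ /(_ n (leqnn n))] := near_infty_natSinv_lt (PosNum (divr_gt0 e0 (@ltr0Sn R 1))).
    by move=> /ltW; exists n.
  pose r : R := n.+1%:R^-1; have r0 : 0 < r by rewrite invr_gt0.
  have appr x : exists q : rat, `|ratr q - x| < r.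
    have /rat_in_itvoo[q] : x - r < x + r by rewrite ltrD2l gtrN.
    by rewrite in_itv /= -ltr_distl => ?; exists q.
  have [q0 hq0] := appr (Y y); have /choice[q hq] := fun i => appr (X y ord0 i).
  have By : ball (c (\row_i q i, q0)) r (X y, Y y).
    rewrite -ball_normE /= (le_lt_trans (y := Num.max 0
      (Num.max `|(c (\row_i q i, q0) - (X y, Y y)).1| `|ratr q0 - Y y|))) //.
      by rewrite prod_normE le_max lexx orbT.
    rewrite !gt_max r0 hq0 /= andbT.
    rewrite /Num.norm /= mx_normrE; apply/bigmax_ltP; split => // -[i j] _ /=.
    by rewrite ord1 !mxE.
  exists ((\row_i q i, q0), n) => //; rewrite /B /=; case: asboolP => // -[] z Bz; apply: He.
  rewrite (splitr e); apply: (@ball_triangle _ _ (c (\row_i q i, q0))).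
    by apply: le_ball ne _ _; apply: ball_sym.
  exact: le_ball ne _ _.
apply: countable_bigcupT_measurable => [|k]; first exact: countableP.
rewrite /B; case: asboolP => // _; set r := _^-1.
have -> : (fun y => (X y, Y y)) @^-1` ball (c k.1) r =
    [set y | forall i, ((fun y => X y ord0 i) @^-1` ball ((c k.1).1 ord0 i) r) y]
    `&` (Y @^-1` ball (c k.1).2 r).
  apply/seteqP; split=> y; first by move=> [[_ b1] b2]; split=> [i|]; [exact: b1|exact: b2].
  move=> -[b1 b2]; split=> //; split=> [|i j]; first by rewrite invr_gt0.
  by rewrite (ord1 i); exact: b1.
apply: measurableI; last first.
  by rewrite -[X in measurable X]setTI; apply: mY => //; exact: measurable_ball.
apply: measurable_forall_ord => i.
by rewrite -[X in measurable X]setTI; apply: mX => //; exact: measurable_ball.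
Qed.

End measurability.

Section lebesgue_tuple.
Context {R : realType}.
Local Notation RT := (measurableTypeR R).
Local Notation mu m := (@lebesgue_tuple R m).

(** The image of Lebesgue measure under [x |-> a x + b], multiplied by [a], gives every half-open
    interval its length; by uniqueness it is Lebesgue measure. *)
Lemma ge0_integral_affine (a b : R) (f : R -> \bar R) : 0 < a ->
  measurable_fun setT f -> (forall x, 0 <= f x)%E ->
  (\int[lebesgue_measure]_x f (a * x + b)%R =
   a^-1%:E * \int[lebesgue_measure]_x f x)%E.
Proof.
move=> a0 mf f0; pose phi (x : RT) : RT := a * x + b.
have mphi : measurable_fun setT phi.
  by apply: measurable_funD => //; apply: measurable_funM.
have eqm A : measurable A -> (lebesgue_measure A = mscale (NngNum (ltW a0)) (pushforward lebesgue_measure phi) A)%E.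
  apply: lebesgue_measure_unique => _ [[x y] _ <-] /=.
  rewrite /mscale /= /pushforward.
  have -> : phi @^-1` `]x, y] = `](x - b) / a, (y - b) / a]%classic.
    apply/seteqP; split=> z; rewrite /phi /= !in_itv /= ltr_pdivrMr // ler_pdivlMr //.
      by rewrite ltrBlDr lerBrDr mulrC.
    by rewrite ltrBlDr lerBrDr mulrC.
  rewrite !lebesgue_measure_itv /= !lte_fin ltr_pM2r ?invr_gt0 // ltrD2r.
  case: ifPn => _; last by rewrite mule0.
  rewrite -!EFinB -EFinM -mulrBl opprB addrA subrK mulrC divfK ?gt_eqF //.
rewrite [in RHS](eq_measure_integral (mscale (NngNum (ltW a0)) (pushforward lebesgue_measure phi))); last first.
  by move=> A mA _; exact: eqm.
rewrite ge0_integral_mscale //= ge0_integral_pushforward //=.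
by rewrite muleA -EFinM mulVf ?gt_eqF // mul1e.
Qed.

Lemma ge0_integral_cons m (f : m.+1.-tuple RT -> \bar R) :
  measurable_fun setT f -> (forall u, 0 <= f u)%E ->
  (\int[mu m.+1]_u f u =
   \int[lebesgue_measure]_x \int[mu m]_u f (cons_pair (x, u)))%E.
Proof.
move=> mf f0; rewrite [LHS](@ge0_integral_pushforward _ _ _ _ _ _ (@measurable_cons_pair R m) _ setT f) //.
rewrite preimage_setT fubini_tonelli1 //=.
by apply: measurableT_comp => //; exact: measurable_cons_pair.
Qed.

Definition affine_tuple m (a : R) (b u : m.-tuple RT) : m.-tuple RT :=
  [tuple a * tnth u i + tnth b i | i < m].

Lemma measurable_affine_tuple m a b : measurable_fun setT (@affine_tuple m a b).
Proof.
apply/measurable_fun_tnthP => i; rewrite /comp /affine_tuple.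
under eq_fun do rewrite tnth_mktuple.
by apply: measurable_funD => //; apply: measurable_funM => //; exact: measurable_tnth.
Qed.

(** Tonelli splits off one coordinate at a time, and each contributes a factor [1/a]. *)
Lemma ge0_integral_affine_tuple m (a : R) (b : m.-tuple RT) (f : m.-tuple RT -> \bar R) :
  0 < a -> measurable_fun setT f -> (forall u, 0 <= f u)%E ->
  (\int[mu m]_u f (affine_tuple a b u) = (a ^- m)%:E * \int[mu m]_u f u)%E.
Proof.
move=> a0; elim: m b f => [|m IH] b f mf f0.
  rewrite expr0 invr1 mul1e; apply: eq_integral => u _; congr f.
  by rewrite [u]tuple0 [LHS]tuple0.
rewrite !ge0_integral_cons //; last first.
  by apply: measurableT_comp => //; exact: measurable_affine_tuple.
pose b0 : R := tnth b ord0; pose b1 : m.-tuple RT := [tuple of behead b].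
have E x u : affine_tuple a b (cons_pair (x, u)) = cons_pair (a * x + b0, affine_tuple a b1 u).
  apply: eq_from_tnth => i; rewrite tnth_mktuple.
  case: (unliftP ord0 i) => [j|] ->; last by rewrite !tnth0.
  by rewrite !tnthS /= tnth_mktuple; congr (_ * _ + _); rewrite !(tnth_nth 0) /= nth_behead.
under eq_integral => x _.
  under eq_integral => u _ do rewrite E.
  rewrite (IH b1 (fun u => f (cons_pair (a * x + b0, u)))) //; last first.
    apply: measurableT_comp => //; apply: measurableT_comp; first exact: measurable_cons_pair.
    exact: measurable_fun_pair.
  over.
have mF : measurable_fun setT (fun x => \int[mu m]_u f (cons_pair (x, u)))%E.
  apply: (@measurable_fun_fubini_tonelli_F _ _ _ _ _ (mu m) (f \o @cons_pair R m)) => [|x]; last exact: f0.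
  by apply: measurableT_comp => //; exact: measurable_cons_pair.
rewrite ge0_integralZl //; last 3 first.
- apply: (measurableT_comp mF) => //; apply: measurable_funD => //; exact: measurable_funM.
- by move=> x _; exact: integral_ge0.
- by rewrite lee_fin invr_ge0 exprn_ge0 // ltW.
rewrite (ge0_integral_affine b0 a0 mF) => [|x]; last exact: integral_ge0.
by rewrite muleA -EFinM -invfM -exprSr.
Qed.

Lemma Rintegral_affine_tuple m (a : R) (b : m.-tuple RT) (f : m.-tuple RT -> R) :
  0 < a -> measurable_fun setT f ->
  \int[mu m]_u f (affine_tuple a b u) = a ^- m * \int[mu m]_u f u.
Proof.
move=> a0 mf; rewrite /Rintegral integralE [in RHS]integralE.
have mf' : measurable_fun setT (EFin \o f) by exact/measurable_EFinP.
set F := EFin \o f in mf' *.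
have gp := ge0_integral_affine_tuple b a0 (measurable_funepos mf') (funepos_ge0 F).
have gn := ge0_integral_affine_tuple b a0 (measurable_funeneg mf') (funeneg_ge0 F).
have -> : (fun u : m.-tuple RT => (f (affine_tuple a b u))%:E) = F \o affine_tuple a b by [].
rewrite (funepos_comp F) (funeneg_comp F) [X in fine (X - _)]gp [X in fine (_ - X)]gn.
set P := (\int[_]_x F^\+ x)%E; set N := (\int[_]_x F^\- x)%E.
have : (0 <= P)%E by apply: integral_ge0.
have : (0 <= N)%E by apply: integral_ge0.
have an0 : 0 < a ^- m by rewrite invr_gt0 exprn_gt0.
(* If one part has an infinite integral, both sides are 0: a positive factor keeps the infinity, and
   [fine] sends it to 0. Integrability is therefore not assumed. *)
case: P => [x||] //; case: N => [y||] // _ _.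
- by rewrite /= mulrBr.
- by rewrite gt0_muley ?lte_fin //= mulr0.
- by rewrite gt0_muley ?lte_fin //= mulr0.
- by rewrite gt0_muley ?lte_fin //= mulr0.
Qed.

Lemma measurable_coord_slice m (j : 'I_m) (A : set RT) : measurable A ->
  measurable [set u : m.-tuple RT | A (tnth u j)].
Proof.
by move=> mA; rewrite -[X in measurable X]setTI; exact: measurable_tnth.
Qed.

Lemma lebesgue_tuple_hyperplane m (j : 'I_m) : mu m [set u | tnth u j = 0] = 0%E.
Proof.
elim: m j => [[]//|m IH] j.
rewrite -[LHS]/((lebesgue_measure \x mu m)%E (@cons_pair R m @^-1` [set u | tnth u j = 0])).
have mj (i : 'I_m) : measurable [set u : m.-tuple RT | tnth u i = 0].
  exact: (measurable_coord_slice i (measurable_set1 (0 : R))).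
case: (unliftP ord0 j) => [i|] ->.
  have -> : @cons_pair R m @^-1` [set u | tnth u (lift ord0 i) = 0] = setT `*` [set u | tnth u i = 0].
    by apply/seteqP; split=> -[x u]; rewrite /= tnthS => //; case.
  by rewrite product_measure1E // IH mule0.
have -> : @cons_pair R m @^-1` [set u | tnth u ord0 = 0] = [set 0] `*` setT.
  by apply/seteqP; split=> -[x u]; rewrite /= tnth0 => //; case.
transitivity (lebesgue_measure [set 0%R] * mu m setT)%E; first exact: product_measure1E.
by rewrite lebesgue_measure_set1 mul0e.
Qed.

Lemma measurable_cube m (r : R) :
  measurable [set u : m.-tuple RT | forall j, `|tnth u j| < r].
Proof.
apply: (@measurable_forall_ord _ _ _ (fun j => [set u : m.-tuple RT | `|tnth u j| < r])) => j.
apply: (measurable_coord_slice j (A := [set x : R | `|x| < r])).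
have -> : [set x : R | `|x| < r] = ball 0 r.
  by apply/seteqP; split=> x; rewrite -ball_normE /= sub0r normrN.
exact: measurable_ball.
Qed.

Lemma lebesgue_tuple_cube m (r : R) : 0 < r ->
  mu m [set u | forall j, `|tnth u j| < r] = ((r *+ 2) ^+ m)%:E.
Proof.
move=> r0; elim: m => [|m IH].
  by rewrite expr0 /= diracE mem_set // => -[].
rewrite -[LHS]/((lebesgue_measure \x mu m)%E (@cons_pair R m @^-1` [set u | forall j, `|tnth u j| < r])).
have -> : @cons_pair R m @^-1` [set u | forall j, `|tnth u j| < r] =
    ball 0 r `*` [set u | forall j, `|tnth u j| < r].
  apply/seteqP; split=> -[x u] /=.
    move=> h; split; first by have := h ord0; rewrite tnth0 -ball_normE /= sub0r normrN.
    by move=> j; have := h (lift ord0 j); rewrite tnthS.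
  rewrite -ball_normE /= sub0r normrN => -[xr h] j.
  by case: (unliftP ord0 j) => [i|] ->; rewrite ?tnthS ?tnth0.
have mC := @measurable_cube m r.
transitivity (lebesgue_measure (ball 0%R r) * mu m [set u | forall j, (`|tnth u j| < r)%R])%E.
  by apply: product_measure1E => //; exact: measurable_ball.
by rewrite IH lebesgue_measure_ball ?ltW // -EFinM -exprS.
Qed.

End lebesgue_tuple.

(** * Euclidean norm, volume of balls, local integrability of [1/|u|] *)

Section euclidean_norm.
Context {R : realType} {m : nat}.
Local Notation RT := (measurableTypeR R).
Local Notation mu := (@lebesgue_tuple R m).
Implicit Types (x : 'rV[R]_m) (u : m.-tuple RT).

(** The inverse is the pointwise limit of the continuous functions [x / (x^2 + 1/(n+1))], also at 0,
    where both sides are 0. *)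
Lemma measurable_invr : measurable_fun setT (fun x : R => x^-1).
Proof.
pose h n (x : R) := x / (x ^+ 2 + n.+1%:R^-1).
have hn0 n (x : R) : x ^+ 2 + n.+1%:R^-1 != 0.
  by rewrite gt_eqF // ltr_wpDl ?sqr_ge0 // invr_gt0.
apply: (@measurable_fun_cvg _ _ _ setT h) => [n|x _].
  apply: continuous_measurable_fun => x.
  rewrite /continuous_at /h; apply: cvgM; first exact: cvg_id.
  apply: cvgV => //; apply: cvgD; last exact: cvg_cst.
  exact: exprn_continuous.
rewrite (_ : x^-1 = x / (x ^+ 2 + 0)); last first.
  by have [->|x0] := eqVneq x 0; [rewrite invr0 mul0r|rewrite addr0; field].
have [->|x0] := eqVneq x 0.
  by rewrite /h mul0r; under eq_fun do rewrite mul0r; exact: cvg_cst.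
apply: cvgM; first exact: cvg_cst.
apply: cvgV; first by rewrite addr0 sqrf_eq0.
apply: cvgD; first exact: cvg_cst.
exact: (@cvg_harmonic R).
Qed.

Lemma eucl_norm_ge0 x : 0 <= eucl_norm x.
Proof. exact: sqrtr_ge0. Qed.

Lemma sqr_eucl_norm x : eucl_norm x ^+ 2 = \sum_(i < m) x ord0 i ^+ 2.
Proof. by rewrite sqr_sqrtr // sumr_ge0 // => i _; exact: sqr_ge0. Qed.

Lemma coord_eucl_norm x i : `|x ord0 i| <= eucl_norm x.
Proof.
rewrite -sqrtr_sqr ler_wsqrtr // (bigD1 i) //= lerDl sumr_ge0 // => j _.
exact: sqr_ge0.
Qed.

Lemma norm_eucl_norm x : `|x| <= eucl_norm x.
Proof. by apply: rV_norm_le => [|i]; [exact: eucl_norm_ge0|exact: coord_eucl_norm]. Qed.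

Lemma eucl_norm_gt0 x i : x ord0 i != 0 -> 0 < eucl_norm x.
Proof. by move=> xi; rewrite (lt_le_trans _ (coord_eucl_norm x i)) ?normr_gt0. Qed.

Lemma eucl_normZ (a : R) x : eucl_norm (a *: x) = `|a| * eucl_norm x.
Proof.
rewrite /eucl_norm -sqrtr_sqr -sqrtrM ?sqr_ge0 // mulr_sumr; congr Num.sqrt.
by apply: eq_bigr => i _; rewrite mxE exprMn.
Qed.

Lemma eucl_norm_lt x (r : R) : (forall i, `|x ord0 i| < r / m.+1%:R) -> 0 < r ->
  eucl_norm x < r.
Proof.
move=> xr r0; rewrite -(ltr_pXn2r (n := 2)) ?nnegrE ?eucl_norm_ge0 ?ltW //.
rewrite sqr_eucl_norm (@le_lt_trans _ _ (\sum_(i < m) (r / m.+1%:R) ^+ 2)) //.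
  apply: ler_sum => i _; rewrite -real_normK ?num_real // lerXn2r ?nnegrE //.
    by rewrite divr_ge0 // ltW.
  exact: ltW.
rewrite sumr_const card_ord -[X in X < _]mulr_natr.
have -> : (r / m.+1%:R) ^+ 2 * m%:R = r ^+ 2 * (m%:R / m.+1%:R ^+ 2).
  by rewrite exprMn exprVn -mulrA [_ * m%:R]mulrC.
rewrite gtr_pMr ?exprn_gt0 // ltr_pdivrMr ?exprn_gt0 // mul1r -natrX ltr_nat.
by rewrite (leq_trans (ltnSn m)) // expnS leq_pmulr.
Qed.

Lemma eucl_norm_continuous : continuous (@eucl_norm R m).
Proof.
move=> x; apply: (@continuous_comp _ _ _ (fun x : 'rV[R]_m => \sum_(i < m) x ord0 i ^+ 2)
  Num.sqrt); last exact: sqrt_continuous.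
apply: (@cvg_rsum R _ (nbhs x) (nbhs_filter x) _ _ (fun i (x : 'rV[R]_m) => x ord0 i ^+ 2)) => i.
apply: (@continuous_comp _ _ _ (fun x : 'rV[R]_m => x ord0 i) (fun y => y ^+ 2)).
  exact: coord_continuous.
exact: exprn_continuous.
Qed.

Lemma measurable_row_of_tuple i :
  measurable_fun setT (fun u => row_of_tuple u ord0 i).
Proof. by under eq_fun do rewrite mxE; exact: measurable_tnth. Qed.

Definition tnorm u : R := eucl_norm (row_of_tuple u).

Lemma measurable_tnorm : measurable_fun setT tnorm.
Proof.
apply: (measurable_continuous (w := fun p : 'rV[R]_m * R => eucl_norm p.1) (Y := fun=> 0)).
- exact: measurable_row_of_tuple.
- exact: measurable_cst.
- by move=> p; apply: continuous_comp; [exact: cvg_fst|exact: eucl_norm_continuous].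
Qed.

Lemma row_of_affine_tuple (a : R) (b u : m.-tuple RT) :
  row_of_tuple (affine_tuple a b u) = a *: row_of_tuple u + row_of_tuple b.
Proof. by apply/rowP => i; rewrite !mxE tnth_mktuple. Qed.

Definition tuple_of_row x : m.-tuple RT := [tuple x ord0 i | i < m].

Lemma tuple_of_rowK x : row_of_tuple (tuple_of_row x) = x.
Proof. by apply/rowP => i; rewrite mxE tnth_mktuple. Qed.

Lemma measurable_tnorm_lt (s : R) : measurable [set u | tnorm u < s].
Proof.
have := measurable_fun_ltr measurable_tnorm (measurable_cst s).
by move=> /(_ measurableT [set true] I); rewrite setTI.
Qed.

Lemma measurable_tnorm_le (s : R) : measurable [set u | tnorm u <= s].
Proof.
have -> : [set u | tnorm u <= s] = tnorm @^-1` `]-oo, s] by apply/seteqP; split=> u; rewrite /= in_itv.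
by rewrite -[X in measurable X]setTI; exact: measurable_tnorm.
Qed.

Lemma lebesgue_tuple_tnorm_fin (s : R) : (mu [set u | (tnorm u < s)%R] < +oo)%E.
Proof.
have C : (mu [set u | forall j, (`|tnth u j| < Num.max s 1)%R] < +oo)%E.
  by rewrite lebesgue_tuple_cube ?ltry // lt_max ltr01 orbT.
apply: le_lt_trans C; apply: le_measure; rewrite ?inE.
- exact: measurable_tnorm_lt.
- exact: measurable_cube.
- move=> u /= us j; rewrite lt_max; apply/orP; left; apply: le_lt_trans us.
  by have := coord_eucl_norm (row_of_tuple u) j; rewrite mxE.
Qed.

Definition unit_ball_volume : R := fine (mu [set u | tnorm u < 1]).

(** Dilation by [1/s] carries the ball of radius [s] to the unit ball. *)
Lemma lebesgue_tuple_tnorm_lt (s : R) : 0 < s ->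
  mu [set u | tnorm u < s] = (s ^+ m * unit_ball_volume)%:E.
Proof.
move=> s0; have ms := measurable_tnorm_lt s; have m1 := measurable_tnorm_lt 1.
rewrite EFinM /unit_ball_volume fineK ?ge0_fin_numE ?lebesgue_tuple_tnorm_fin //.
rewrite -[X in mu X]setIT -[X in (_ * mu X)%E]setIT -!integral_indic //.
have i0 : 0 < s^-1 by rewrite invr_gt0.
have := @ge0_integral_affine_tuple R m s^-1 (tuple_of_row 0) (EFin \o \1_[set u | tnorm u < 1]) i0.
rewrite exprVn invrK => <-; last 2 first.
- exact/measurable_EFinP/measurable_indic.
- by move=> u; rewrite lee_fin.
apply: eq_integral => u _ /=; rewrite !indicE; congr (_ %:R%:E); congr (nat_of_bool _).
rewrite /mem /= /in_mem /=; apply/asbool_equiv_eq => /=.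
by rewrite /tnorm row_of_affine_tuple tuple_of_rowK addr0 eucl_normZ gtr0_norm // mulrC ltr_pdivrMr // mul1r.
Qed.

(** The ball contains a cube of half-side [1/(m+1)]. Positivity is what makes [flat_factor]
    nonzero. *)
Lemma unit_ball_volume_gt0 : 0 < unit_ball_volume.
Proof.
rewrite /unit_ball_volume fine_gt0 // lebesgue_tuple_tnorm_fin andbT.
have e0 : 0 < 1 / m.+1%:R :> R by rewrite divr_gt0.
apply: (@lt_le_trans _ _ (mu [set u | forall j, (`|tnth u j| < 1 / m.+1%:R)%R])).
  by rewrite lebesgue_tuple_cube // lte_fin exprn_gt0 // pmulrn_lgt0.
apply: le_measure; rewrite ?inE.
- exact: measurable_cube.
- exact: measurable_tnorm_lt.
- by move=> u /= h; apply: eucl_norm_lt => // i; rewrite mxE.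
Qed.

(* [1/r] is the integral of [1/r^2] over [r < s < 2r], and [4/s^2] is larger
   there; after exchanging the integrals, [s^m/s^2] is bounded as [m >= 2]. *)
Lemma integrable_inv_tnorm (M : R) : (1 < m)%N ->
  mu.-integrable [set u | tnorm u <= M] (fun u => (tnorm u)^-1%:E).
Proof.
move=> m1.
have minv : measurable_fun setT (fun u => (tnorm u)^-1).
  by apply: measurableT_comp; [exact: measurable_invr|exact: measurable_tnorm].
have mM := measurable_tnorm_le M.
apply/integrableP; split; first by apply/measurable_EFinP; exact: measurable_funTS.
(* For [r <= M] the interval from [r] to [2r] lies below [N]; the summand 1 keeps [N] positive. *)
pose N : R := 2 * (`|M| + 1).
have N0 : 0 < N by rewrite mulr_gt0 // ltr_wpDl.
pose g (z : m.-tuple RT * RT) : R :=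
  if (tnorm z.1 < z.2) && (z.2 < N) then 4 * z.2^-1 ^+ 2 else 0.
have g0 z : 0 <= g z by rewrite /g; case: ifP => // _; rewrite mulr_ge0 // sqr_ge0.
have mg : measurable_fun setT (EFin \o g).
  apply/measurable_EFinP; apply: measurable_fun_ifT.
  - apply: measurable_and; apply: measurable_fun_ltr => //.
    by apply: measurableT_comp; [exact: measurable_tnorm|exact: measurable_fst].
  - apply: measurable_funM => //; apply: measurable_funX.
    by apply: measurableT_comp; [exact: measurable_invr|exact: measurable_snd].
  - exact: measurable_cst.
apply: (@le_lt_trans _ _ (\int[mu]_u \int[lebesgue_measure]_s (g (u, s))%:E)%E).
  rewrite integral_mkcond; apply: ge0_le_integral => //.
  - by move=> u _; rewrite /patch; case: ifP.
  - apply/(measurable_restrictT _ mM); apply: measurable_funTS; apply/measurable_EFinP.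
    exact: measurableT_comp.
  - exact: (@measurable_fun_fubini_tonelli_F _ _ _ _ _ lebesgue_measure (EFin \o g)).
  move=> u _; rewrite /patch; case: ifPn => [|_]; last first.
    by apply: integral_ge0 => s _; rewrite lee_fin.
  rewrite inE /= => rM; set r := tnorm u in rM *.
  (* At the origin the inverse is 0 by convention, so the lower bound is trivial there. *)
  have [r0|] := eqVneq r 0.
    by rewrite r0 invr0 normr0; apply: integral_ge0 => s _; rewrite lee_fin.
  move=> /negPf rn0; have r0 : 0 < r by rewrite lt_def rn0 eucl_norm_ge0.
  have rN : 2 * r < N by rewrite ltr_pM2l // (le_lt_trans rM) // (le_lt_trans (ler_norm M)) // ltrDl.
  apply: (@le_trans _ _ (\int[lebesgue_measure]_(s in `]r, (2 * r)%R[) (r^-1 ^+ 2)%:E)%E).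
    rewrite integral_cst //= lebesgue_measure_itv /= lte_fin ifT; last by lra.
    rewrite -EFinB -EFinM lee_fin ger0_norm; last by rewrite invr_ge0 ltW.
    have -> : 2 * r - r = r by ring.
    by have -> : r^-1 ^+ 2 * r = r^-1 by field; rewrite rn0.
  apply: (@le_trans _ _ (\int[lebesgue_measure]_(s in `]r, (2 * r)%R[) (g (u, s))%:E)%E).
    apply: ge0_le_integral => //.
    - by move=> s _; rewrite lee_fin sqr_ge0.
    - apply: measurable_funTS; apply: (measurableT_comp mg); exact: measurable_pair1.
    move=> s; rewrite /= in_itv /= => /andP[rs sr].
    rewrite lee_fin /g /= -/r rs (lt_trans sr rN) /=.
    have s0 : 0 < s by exact: lt_trans rs.
    have -> : (4 : R) = 2 ^+ 2 by ring.
    rewrite -exprMn lerXn2r ?nnegrE ?mulr_ge0 ?invr_ge0 ?ltW //.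
    by rewrite ltr_pdivlMr // mulrC ltr_pdivrMr.
  apply: ge0_subset_integral => //.
  - apply: (measurableT_comp mg); exact: measurable_pair1.
  - by move=> s _; rewrite lee_fin.
have := @fubini_tonelli _ _ _ _ _ mu lebesgue_measure (EFin \o g) mg.
rewrite /fubini_F /fubini_G /= => -> //.
(* The inner integral is [4 s^(-2)] times the volume [V s^m] of a ball, that is [4 V s^(m-2)], and
   [s < N]. *)
pose C := 4 * (N ^+ (m - 2) * unit_ball_volume).
have C0 : 0 <= C by rewrite mulr_ge0 // mulr_ge0 ?exprn_ge0 ?ltW // unit_ball_volume_gt0.
apply: (@le_lt_trans _ _ (\int[lebesgue_measure]_(s in `]0%R, N[) C%:E)%E); last first.
  by rewrite integral_cst //= lebesgue_measure_itv /= lte_fin N0 -EFinB -EFinM ltry.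
rewrite [leRHS]integral_mkcond; apply: ge0_le_integral => //.
- by move=> s _; apply: integral_ge0 => u _; rewrite lee_fin.
- exact: (@measurable_fun_fubini_tonelli_G _ _ _ _ _ mu (EFin \o g)).
- by apply/(measurable_restrictT _ _).1 => //; exact: measurable_cst.
move=> s _; rewrite /patch; case: ifPn => [|/negP sN].
  rewrite inE /= in_itv /= => /andP[s0 sN].
  have -> : (\int[mu]_u (g (u, s))%:E = \int[mu]_(u in [set u | (tnorm u < s)%R]) (4 * s^-1 ^+ 2)%:E)%E.
    rewrite [RHS]integral_mkcond; apply: eq_integral => u _.
    rewrite /patch /g /= sN andbT; case: ifPn => [us|us]; first by rewrite mem_set.
    by rewrite memNset //; apply/negP.
  rewrite integral_cst //; last exact: measurable_tnorm_lt.
  rewrite [X in (_ * X <= _)%E](lebesgue_tuple_tnorm_lt s0) -EFinM lee_fin /C -mulrA ler_pM2l //.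
  rewrite mulrA ler_wpM2r ?(ltW unit_ball_volume_gt0) //.
  rewrite -[in X in X <= _](subnKC m1) exprD mulrA -exprMn mulVf ?gt_eqF // expr1n mul1r.
  by rewrite lerXn2r ?nnegrE ?ltW.
rewrite integral0_eq ?lexx // => u _; rewrite /g /=; case: ifPn => // /andP[us sN'].
case: sN; rewrite inE /= in_itv /= sN' andbT.
exact: le_lt_trans (eucl_norm_ge0 _) us.
Qed.

End euclidean_norm.

(** Dominated convergence is about sequences, so the continuity of parameter integrals is tested on
    them. *)
Lemma seq_continuous_at (R : realType) (V : normedModType R) (F : V -> R) (p : V) :
  (forall u : nat -> V, u n @[n --> \oo] --> p -> F (u n) @[n --> \oo] --> F p) ->
  {for p, continuous F}.
Proof.
move=> H; apply/cvgrPdist_lt => e e0; apply: contrapT => notnear.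
have /choice[u uP] : forall n : nat, exists q, `|p - q| < n.+1%:R^-1 /\ e <= `|F p - F q|.
  move=> n; apply: contrapT => noq; apply: notnear.
  apply/nbhs_ballP; exists n.+1%:R^-1; first by rewrite /= invr_gt0.
  move=> q; rewrite -ball_normE /= => pq; rewrite ltNge; apply/negP => Fq.
  by apply: noq; exists q.
have up : u n @[n --> \oo] --> p.
  apply/cvgrPdist_lt => d d0; near=> n; apply: (lt_trans (uP n).1).
  by near: n; exact: (near_infty_natSinv_lt (PosNum d0)).
have /cvgrPdist_lt /(_ _ e0) [N _ HN] := H u up.
by have := HN N (leqnn N); rewrite /= ltNge (uP N).2.
Unshelve. all: by end_near. Qed.

Lemma affine_is_derive (R : realType) (a b s : R) : is_derive s 1 (fun h : R => a + h * b) b.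
Proof.
rewrite (_ : (fun h => _) = cst a + (b \*: id)); last first.
  by apply/funext => h; rewrite fctE /= [h * _]mulrC.
by apply: is_derive_eq; rewrite add0r -[_ *: _]/(_ * _) mulr1.
Qed.

(** * Superpositions of dilated and shifted copies *)

Section past_functions.
Context {R : realType} {m : nat}.
Local Notation spacetime := ('rV[R]_m * R)%type.
Implicit Types (f g w : spacetime -> R) (p q v : spacetime).

Definition past_supported w := exists t0 : R, forall p, t0 < p.2 -> w p = 0.

Definition past_smooth w := Cinf w /\ past_supported w.

Lemma past_supported_pd w j : past_supported w -> past_supported (pd j w).
Proof.
move=> [t0 wt]; exists t0 => p pt; rewrite pdE -[RHS](derive_cst (0 : R) p (axis j)).
apply: near_eq_derive.
have : \forall q \near p, t0 < q.2.
  have c : (fun q : spacetime => q.2) @ p --> p.2 by exact: cvg_snd.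
  exact: (cvgr_gt p.2 c).
by apply: filterS => q; exact: wt.
Qed.

Lemma past_supportedD f g : past_supported f -> past_supported g -> past_supported (f + g).
Proof.
move=> [t0 ft] [t1 gt]; exists (Num.max t0 t1) => p; rewrite gt_max => /andP[p0 p1].
by rewrite fctE ft // gt // addr0.
Qed.

Lemma past_supportedZ (a : R) f : past_supported f -> past_supported (a *: f).
Proof. by move=> [t0 ft]; exists t0 => p pt; rewrite fctE ft // scaler0. Qed.

Lemma past_supported_mulcoord i c f : past_supported f -> past_supported (mulcoord i c f).
Proof. by move=> [t0 ft]; exists t0 => p pt; rewrite /mulcoord ft // mulr0. Qed.

Lemma past_smooth0 : past_smooth 0.
Proof. by split; [exact: Cinf0|exists 0]. Qed.

Lemma past_smooth_pd j w : past_smooth w -> past_smooth (pd j w).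
Proof. by move=> [sw pw]; split; [exact: Cinf_pd|exact: past_supported_pd]. Qed.

Lemma past_smoothD f g : past_smooth f -> past_smooth g -> past_smooth (f + g).
Proof. by move=> [sf pf] [sg pg]; split; [exact: CinfD|exact: past_supportedD]. Qed.

Lemma past_smoothZ (a : R) f : past_smooth f -> past_smooth (a *: f).
Proof. by move=> [sf pf]; split; [exact: CinfZ|exact: past_supportedZ]. Qed.

Lemma past_smooth_sum (I : Type) (r : seq I) (F : I -> spacetime -> R) :
  (forall i, past_smooth (F i)) -> past_smooth (\sum_(i <- r) F i).
Proof.
move=> sF; elim: r => [|i r IH]; first by rewrite big_nil; exact: past_smooth0.
by rewrite big_cons; exact: past_smoothD.
Qed.

Lemma past_smooth_mulcoord i c f : past_smooth f -> past_smooth (mulcoord i c f).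
Proof. by move=> [sf pf]; split; [exact: Cinf_mulcoord|exact: past_supported_mulcoord]. Qed.

Lemma past_smooth_box f : past_smooth f -> past_smooth (box f).
Proof.
move=> sf; rewrite boxE; apply: past_smoothD; first by do 2!apply: past_smooth_pd.
by apply: past_smoothZ; apply: past_smooth_sum => i; do 2!apply: past_smooth_pd.
Qed.

Lemma compact_norm_le (B : R) : compact [set q : spacetime | `|q| <= B].
Proof.
have -> : [set q : spacetime | `|q| <= B] = [set x | `|x| <= B] `*` [set t | `|t| <= B].
  by apply/seteqP; split=> q /=; rewrite norm_le => /andP.
have cl (V : normedModType R) : closed [set x : V | `|x| <= B].
  have -> : [set x : V | `|x| <= B] = Num.norm @^-1` [set x | x <= B] by [].
  by apply: preimage_closed (@closed_le R B) => x _; exact: norm_continuous.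
apply: compact_setX.
  apply: bounded_closed_compact; last exact: cl.
  by exists B; split=> [|M BM x /= xB]; [exact: num_real|exact: le_trans (ltW BM)].
have -> : [set t : R | `|t| <= B] = `[- B, B]%classic.
  by apply/seteqP; split=> t /=; rewrite in_itv /= ler_norml.
exact: segment_compact.
Qed.

Lemma continuous_bounded w (B : R) : continuous w ->
  exists2 C : R, 0 <= C & forall q, `|q| <= B -> `|w q| <= C.
Proof.
move=> cw; have cB := @compact_norm_le B.
have cwB : compact (w @` [set q | `|q| <= B]).
  by apply: continuous_compact cB; exact: continuous_subspaceT.
have [M [_ HM]] := compact_bounded cwB.
exists (`|M| + 1); first by rewrite addr_ge0.
move=> q qB; apply: (HM (`|M| + 1)); last by exists q.
by rewrite (le_lt_trans (ler_norm M)) // ltrDl.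
Qed.

End past_functions.

(** * Integrals of displaced copies: majorants, continuity, derivatives *)

Section superposition.
Context {R : realType} {m : nat} {d : measure_display} {Y : measurableType d}.
Variable nu : {measure set Y -> \bar R}.
Variables (dil : Y -> R) (sh : Y -> 'rV[R]_m) (delay : Y -> R).
Local Notation spacetime := ('rV[R]_m * R)%type.
Implicit Types (f g w : spacetime -> R) (p q v : spacetime) (ker : Y -> R).

(* Cone transforms, integrals over the future and averages over segments are
   all of this form. *)
Definition displace (y : Y) p : spacetime := (dil y *: p.1 + sh y, p.2 + delay y).

Definition superpose ker w : spacetime -> R := fun p =>
  \int[nu]_y (ker y * w (displace y p)).

(** If [w] vanishes after [t0], only delays up to [t0 - t] contribute. There the kernel is
    integrable and the displaced points stay bounded, which gives integrable majorants that are
    locally uniform in the point. The last two conditions are asked only where the kernel is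
    nonzero, because kernels supported on a half-line or an interval occur. *)
Record admissible ker : Prop := Admissible {
  adm_ker : measurable_fun setT ker;
  adm_dil : measurable_fun setT dil;
  adm_sh : forall i, measurable_fun setT (fun y => sh y ord0 i);
  adm_delay : measurable_fun setT delay;
  adm_int : forall M, nu.-integrable [set y | delay y <= M] (EFin \o ker);
  adm_past : forall y, ker y != 0 -> 0 <= delay y;
  adm_bound : forall M, exists A : R, forall y, ker y != 0 -> delay y <= M ->
    `|dil y| <= A /\ `|sh y| <= A }.

Lemma measurable_delay_le ker (M : R) : admissible ker -> measurable [set y | delay y <= M].
Proof.
move=> a; have -> : [set y | delay y <= M] = delay @^-1` `]-oo, M] by apply/seteqP; split=> y; rewrite /= in_itv.
by rewrite -[X in measurable X]setTI; exact: adm_delay a measurableT _ _.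
Qed.

(** A space derivative brings out the dilation as a factor, so the kernels have to be stable under
    it. *)
Lemma admissibleM ker : admissible ker -> admissible (fun y => ker y * dil y).
Proof.
move=> a; split.
- by apply: measurable_funM; [exact: adm_ker a|exact: adm_dil a].
- exact: adm_dil a.
- exact: adm_sh a.
- exact: adm_delay a.
- move=> M; have [A HA] := adm_bound a M; have mM := measurable_delay_le M a.
  apply: (@le_integrable _ _ _ _ _ mM _ (fun y => (A * ker y)%:E)).
  + apply/measurable_EFinP; apply: measurable_funTS.
    by apply: measurable_funM; [exact: adm_ker a|exact: adm_dil a].
  + move=> y yM; rewrite /= lee_fin !normrM mulrC.
    have [->|k0] := eqVneq (ker y) 0; first by rewrite normr0 !mulr0.
    rewrite ler_wpM2r // (le_trans _ (ler_norm A)) //.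
    by have [] := HA y k0 yM.
  + rewrite (_ : (fun y => _) = (fun y => A%:E * (EFin \o ker) y)%E); last by apply/funext => y; rewrite EFinM.
    by apply: integrableZl => //; exact: adm_int a M.
- by move=> y; rewrite mulf_eq0 negb_or => /andP[k0 _]; exact: adm_past a _ k0.
- move=> M; have [A HA] := adm_bound a M; exists A => y.
  by rewrite mulf_eq0 negb_or => /andP[k0 _]; exact: HA.
Qed.

Lemma measurable_displace ker w p : admissible ker -> continuous w ->
  measurable_fun setT (fun y => w (displace y p)).
Proof.
move=> a cw; apply: measurable_continuous => [i||] //.
  under eq_fun do rewrite !mxE.
  by apply: measurable_funD; [apply: measurable_funM => //; exact: adm_dil a|exact: adm_sh a i].
by apply: measurable_funD => //; exact: adm_delay a.
Qed.

Lemma superpose_dominated ker w (rho : R) : admissible ker -> continuous w ->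
  past_supported w -> exists G : Y -> R,
  [/\ forall y, 0 <= G y, nu.-integrable setT (EFin \o G) &
   forall p y, `|p| <= rho -> `|ker y * w (displace y p)| <= G y].
Proof.
(* A point of norm at most [rho] that is delayed by more than [M] lands after [t0]; [B] bounds the
   displaced points for the other delays. *)
move=> a cw [t0 wt]; pose M := t0 + rho.
have [A HA] := adm_bound a M; pose B := Num.max (`|A| * rho + `|A|) (rho + `|M|).
have [C C0 HC] := continuous_bounded B cw.
pose S := [set y | delay y <= M]; have mS : measurable S := measurable_delay_le M a.
exists (fun y => C * (`|ker y| * \1_S y)); split=> [y||p y prho].
- by rewrite mulr_ge0 // mulr_ge0.
- have : nu.-integrable setT (fun y => C%:E * (((fun y => `|(ker y)%:E|) \_ S) y))%E.
    apply: integrableZl => //; apply/(integrable_mkcond _ mS).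
    by apply: integrable_abse; exact: adm_int a M.
  apply: eq_integrable => // y _; rewrite /= !EFinM /patch indicE.
  by case: ifP => _; rewrite ?mulr1 ?mule1 ?mule0.
have [->|k0] := eqVneq (ker y) 0; first by rewrite mul0r normr0 mul0r mulr0.
have /andP[p1 p2] : (`|p.1| <= rho) && (`|p.2| <= rho) by rewrite -norm_le.
have d0 := adm_past a k0; rewrite indicE.
have [yM|yM] := leP (delay y) M; last first.
  rewrite (wt (displace y p)) ?mulr0 ?normr0 ?mulr_ge0 //=.
  move: p2; rewrite ler_norml => /andP[p2 _].
  by rewrite /M in yM; lra.
rewrite mem_set // mulr1 normrM mulrC ler_wpM2r // HC // norm_le /= !le_max.
have [lA sA] := HA y k0 yM; apply/andP; split; apply/orP; [left|right].
  rewrite (le_trans (ler_normD _ _)) // lerD ?(le_trans sA (ler_norm A)) //.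
  by rewrite normrZ ler_pM // (le_trans lA (ler_norm A)).
rewrite (le_trans (ler_normD _ _)) // lerD // ger0_norm //.
by rewrite (le_trans yM (ler_norm M)).
Qed.

Lemma superpose_integrable ker w p : admissible ker -> continuous w -> past_supported w ->
  nu.-integrable setT (fun y => (ker y * w (displace y p))%:E).
Proof.
move=> a cw pw; have [G [G0 iG HG]] := superpose_dominated `|p| a cw pw.
apply: le_integrable iG => //.
  apply/measurable_EFinP; apply: measurable_funM; first exact: adm_ker a.
  exact: measurable_displace a cw.
by move=> y _; rewrite /= lee_fin (ger0_norm (G0 y)) HG.
Qed.

Lemma superpose_continuous ker w : admissible ker -> continuous w -> past_supported w ->
  continuous (superpose ker w).
Proof.
move=> a cw pw p; apply: seq_continuous_at => u up.
pose rho := `|p| + 1.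
(* The majorant is valid on the ball of radius [rho]. Replacing the finitely many terms outside by
   [p] makes it valid for every [n]. *)
pose u' n := if `|u n| <= rho then u n else p.
have near_u : \forall n \near \oo, u' n = u n.
  have : \forall n \near \oo, `|u n| < rho by apply: (cvgr_lt `|p|); [exact: cvg_norm|rewrite ltrDl].
  by apply: filterS => n un; rewrite /u' ltW.
have u'p : u' n @[n --> \oo] --> p.
  by apply: cvg_trans up; apply: near_eq_cvg; apply: filterS near_u.
suff L : superpose ker w (u' n) @[n --> \oo] --> superpose ker w p.
  apply: cvg_trans L; apply: near_eq_cvg; apply: filterS near_u => n <- //.
have u'rho n : `|u' n| <= rho by rewrite /u'; case: ifP => //; rewrite lerDl.
have [G [G0 iG HG]] := superpose_dominated rho a cw pw.
have mf q : measurable_fun setT (fun y => (ker y * w (displace y q))%:E).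
  exact: measurable_int (superpose_integrable q a cw pw).
have [] := @dominated_convergence _ _ _ nu setT measurableT
  (fun n y => (ker y * w (displace y (u' n)))%:E) (fun y => (ker y * w (displace y p))%:E)
  (EFin \o G) (fun n => mf _) (mf p) _ iG _.
- apply/aeW => y _; apply: cvg_EFin; first exact: nearW.
  apply: cvgM; first exact: cvg_cst.
  apply: (@cvg_comp _ _ _ (fun n => displace y (u' n)) w _ (nbhs (displace y p))); last exact: cw.
  have c1 : dil y *: (u' n).1 + sh y @[n --> \oo] --> dil y *: p.1 + sh y.
    apply: cvgD; last exact: cvg_cst.
    by apply: cvgZl_tmp; apply: cvg_comp u'p _; exact: cvg_fst.
  have c2 : (u' n).2 + delay y @[n --> \oo] --> p.2 + delay y.
    by apply: cvgD; last exact: cvg_cst; apply: cvg_comp u'p _; exact: cvg_snd.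
  exact: (cvg_pair c1 c2).
- by apply/aeW => y n _; rewrite /= lee_fin HG.
move=> _ _ L; apply: fine_cvg.
rewrite /superpose /Rintegral fineK //.
exact: integrable_fin_num (superpose_integrable p a cw pw).
Qed.

Definition dil_factor (j : option 'I_m) (y : Y) : R := if j is Some _ then dil y else 1.

Lemma admissible_factor ker j : admissible ker -> admissible (fun y => ker y * dil_factor j y).
Proof.
case: j => [i|] a; first exact: admissibleM.
by rewrite /dil_factor /= (_ : (fun y => _) = ker) //; apply/funext => y; rewrite mulr1.
Qed.

Lemma stcoord_displace i j y (h : R) p :
  stcoord i (displace y (h *: axis j + p)) =
  stcoord i (displace y p) + h * ((i == j)%:R * dil_factor j y).
Proof.
case: i j => [i|] [j|] /=; rewrite ?mxE ?scaler0 ?add0r ?eqxx /=.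
- by rewrite (_ : (Some i == Some j) = (i == j)) //; ring.
- by ring.
- by rewrite mul0r mulr0 addr0.
- by rewrite -[_ *: _]/(_ * _); ring.
Qed.

Lemma displace_is_derive w j p y (s : R) : Cinf w ->
  is_derive s 1 (fun s : R => w (displace y (s *: axis j + p)))
    (dil_factor j y * pd j w (displace y (s *: axis j + p))).
Proof.
move=> sw; pose c i : R := (i == j)%:R * dil_factor j y.
have E i h : stcoord i (displace y (h *: axis j + p)) = stcoord i (displace y p) + h * c i.
  exact: stcoord_displace.
have dc i : is_derive s 1 (fun h => stcoord i (displace y (h *: axis j + p))) (c i).
  rewrite (_ : (fun h => _) = (fun h => stcoord i (displace y p) + h * c i)); last exact/funext.
  exact: affine_is_derive.
have := chain_rule (Cinf_c1 sw) dc; rewrite (bigD1 j) //= big1 => [|i ij]; last first.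
  by rewrite /c (negbTE ij) !mul0r.
by rewrite /c eqxx mul1r addr0 pd.unlock.
Qed.

Lemma superpose_is_derive ker w j p : admissible ker -> past_smooth w ->
  is_derive p (axis j) (superpose ker w)
    (superpose (fun y => ker y * dil_factor j y) (pd j w) p).
Proof.
move=> a sw; have [cw pw] := sw; have [cj pj] := past_smooth_pd j sw.
have af := admissible_factor j a.
pose f (h : R) (y : Y) := ker y * w (displace y (h *: axis j + p)).
have df y (s : R) : is_derive s 1 (f ^~ y)
    (ker y * dil_factor j y * pd j w (displace y (s *: axis j + p))).
  by rewrite -mulrA; apply: is_deriveZ; exact: displace_is_derive.
(* The parameter runs over []-1, 1[] and the axis has norm at most 1, so the moving point has norm
   at most [|p| + 1]. *)
have [G [G0 iG HG]] := superpose_dominated (`|p| + 1) af (Cinf_continuous cj) pj.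
have L : h^-1 *: (superpose ker w (h *: axis j + p) - superpose ker w p) @[h --> 0^'] -->
    superpose (fun y => ker y * dil_factor j y) (pd j w) p.
  have D1 x y : partial1of2 f x y = ker y * dil_factor j y * pd j w (displace y (x *: axis j + p)).
    by rewrite partial1of2E derive_val.
  have := @cvg_differentiation_under_integral R _ Y nu f setT measurableT 0 (-1) 1 _ _ _ G G0 iG _.
  rewrite (_ : (fun h => h^-1 *: (_ - _)) =
    (fun h => h^-1 *: (superpose ker w (h *: axis j + p) - superpose ker w p))); last first.
    by apply/funext => h; rewrite /f addr0 scale0r add0r.
  rewrite (_ : \int[nu]_(y in setT) _ = superpose (fun y => ker y * dil_factor j y) (pd j w) p); last first.
    by apply: eq_Rintegral => y _; rewrite D1 scale0r add0r.
  apply.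
  - by rewrite /= in_itv /= ltrN10 ltr01.
  - by move=> x _; apply: superpose_integrable => //; exact: Cinf_continuous.
  - by move=> x y _ _; apply: ex_derive.
  - move=> x y; rewrite /= in_itv /= => /andP[x0 x1] _; rewrite D1; apply: HG.
    rewrite addrC (le_trans (ler_normD _ _)) // lerD // normrZ.
    have x2 : `|x| <= 1 by rewrite ler_norml !ltW.
    by rewrite (le_trans (ler_pM _ _ x2 (norm_axis j))) ?mulr1.
by apply: DeriveDef; [apply/cvg_ex; eexists; exact: L|exact: cvg_lim L].
Qed.

Lemma pd_superpose ker w j : admissible ker -> past_smooth w ->
  pd j (superpose ker w) = superpose (fun y => ker y * dil_factor j y) (pd j w).
Proof. by move=> a sw; apply/funext => p; apply: pd_val; exact: superpose_is_derive. Qed.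

(** Every iterated derivative is again a superposition, of the same derivative of [w] with the
    kernel multiplied by dilation factors. Singular kernels therefore cost no smoothness. *)
Lemma past_smooth_superpose ker w : admissible ker -> past_smooth w ->
  past_smooth (superpose ker w).
Proof.
move=> a sw; split.
  apply/CinfP => s; have [k [ak [ps ->]]] : exists k, admissible k /\
      (past_smooth (foldr pd w s) /\ foldr pd (superpose ker w) s = superpose k (foldr pd w s)).
    elim: s => [|j s [k [ak [ps IH]]]] /=; first by exists ker.
    exists (fun y => k y * dil_factor j y); split; first exact: admissible_factor.
    by rewrite IH pd_superpose //; split => //; exact: past_smooth_pd.
  split=> [|j p]; last by apply: ex_derive; exact: superpose_is_derive.
  by case: ps => cs ps; apply: superpose_continuous => //; exact: Cinf_continuous.
have [_ [t0 wt]] := sw; exists t0 => p pt.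
rewrite /superpose (_ : (fun y => _) = cst 0) ?Rintegral_cst ?mul0r //.
apply/funext => y /=; have [->|k0] := eqVneq (ker y) 0; first by rewrite mul0r.
by rewrite wt ?mulr0 //=; have := adm_past a k0; lra.
Qed.

Lemma superposeD ker f g : admissible ker -> past_smooth f -> past_smooth g ->
  superpose ker (f + g) = superpose ker f + superpose ker g.
Proof.
move=> a [sf pf] [sg pg]; apply/funext => p; rewrite fctE /superpose.
under eq_Rintegral do rewrite mulrDr.
by rewrite RintegralD //; apply: superpose_integrable => //; exact: Cinf_continuous.
Qed.

Lemma superposeZ ker (c : R) f : admissible ker -> past_smooth f ->
  superpose ker (c *: f) = c *: superpose ker f.
Proof.
move=> a [sf pf]; apply/funext => p; rewrite fctE /superpose.
under eq_Rintegral do rewrite -[c *: _]/(c * _) mulrCA.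
by rewrite RintegralZl //; apply: superpose_integrable => //; exact: Cinf_continuous.
Qed.

Lemma superpose0 ker : superpose ker 0 = 0.
Proof.
apply/funext => p; rewrite /superpose (_ : (fun y => _) = cst 0) ?Rintegral_cst ?mul0r //.
by apply/funext => y; rewrite mulr0.
Qed.

Lemma superpose_sum ker (I : Type) (r : seq I) (F : I -> spacetime -> R) :
  admissible ker -> (forall i, past_smooth (F i)) ->
  superpose ker (\sum_(i <- r) F i) = \sum_(i <- r) superpose ker (F i).
Proof.
move=> a sF; elim: r => [|i r IH]; first by rewrite !big_nil superpose0.
by rewrite !big_cons superposeD ?IH //; exact: past_smooth_sum.
Qed.

End superposition.

Lemma Rintegral_exchange d1 d2 (T1 : measurableType d1) (T2 : measurableType d2)
    (R : realType) (m1 : {sigma_finite_measure set T1 -> \bar R})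
    (m2 : {sigma_finite_measure set T2 -> \bar R}) (f : T1 * T2 -> R)
    (G1 : T1 -> R) (G2 : T2 -> R) :
  measurable_fun setT f -> m1.-integrable setT (EFin \o G1) ->
  m2.-integrable setT (EFin \o G2) -> (forall x y, `|f (x, y)| <= G1 x * G2 y) ->
  \int[m1]_x \int[m2]_y f (x, y) = \int[m2]_y \int[m1]_x f (x, y).
Proof.
move=> mf i1 i2 fG.
have mf' : measurable_fun setT (EFin \o f) by exact/measurable_EFinP.
have i1x x : m2.-integrable setT (fun y => (f (x, y))%:E).
  apply: (@le_integrable _ _ _ _ _ measurableT _ (fun y => ((G1 x)%:E * (EFin \o G2) y)%E)).
  - by apply: measurableT_comp mf' _; exact: pair1_measurable.
  - by move=> y _; rewrite /= lee_fin (le_trans (fG x y)) // ler_norm.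
  - exact: integrableZl.
have i2y y : m1.-integrable setT (fun x => (f (x, y))%:E).
  apply: (@le_integrable _ _ _ _ _ measurableT _ (fun x => ((G2 y)%:E * (EFin \o G1) x)%E)).
  - by apply: measurableT_comp mf' _; exact: pair2_measurable.
  - by move=> x _; rewrite /= lee_fin (le_trans (fG x y)) // mulrC ler_norm.
  - exact: integrableZl.
have ii : (m1 \x m2)%E.-integrable setT (EFin \o f).
  apply/integrable12ltyP => //.
  apply: (@le_lt_trans _ _ (\int[m1]_x (`|(G1 x)%:E| * \int[m2]_y `|(G2 y)%:E|))%E).
    apply: ge0_le_integral => //.
    - by move=> x _; apply: integral_ge0.
    - apply: (@measurable_fun_fubini_tonelli_F _ _ _ _ _ m2 (abse \o (EFin \o f))) => [|x]; last exact: abse_ge0.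
      exact: measurableT_comp.
    - apply: emeasurable_funM => //; apply: measurableT_comp => //; exact: measurable_int i1.
    move=> x _; rewrite -ge0_integralZl //; last first.
      by apply: measurableT_comp => //; exact: measurable_int i2.
    apply: ge0_le_integral => //.
    - by apply: measurableT_comp => //; exact: measurable_int (i1x x).
    - apply: emeasurable_funM => //; apply: measurableT_comp => //; exact: measurable_int i2.
    - by move=> y _; rewrite /= lee_fin -normrM (le_trans (fG x y)) // ler_norm.
  move: i1 i2 => /integrableP[mG1 oo1] /integrableP[mG2 oo2].
  rewrite ge0_integralZr //; last 2 first.
  - exact: measurableT_comp.
  - exact: integral_ge0.
  by rewrite lte_mul_pinfty // ?ge0_fin_numE //; apply: integral_ge0.
rewrite /Rintegral.
under eq_integral => x _ do rewrite fineK ?(integrable_fin_num measurableT (i1x x)) //.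
under [in RHS]eq_integral => y _ do rewrite fineK ?(integrable_fin_num measurableT (i2y y)) //.
by congr fine; exact: (Fubini ii).
Qed.

Lemma Rintegral_sum d (T : measurableType d) (R : realType) (mu : {measure set T -> \bar R})
    (I : Type) (r : seq I) (F : I -> T -> R) :
  (forall i, mu.-integrable setT (EFin \o F i)) ->
  mu.-integrable setT (fun u => (\sum_(i <- r) F i u)%:E) /\
  \int[mu]_u (\sum_(i <- r) F i u) = \sum_(i <- r) \int[mu]_u F i u.
Proof.
move=> iF; elim: r => [|i r [IH1 IH2]].
  under eq_fun do rewrite big_nil; rewrite big_nil; split; first exact: integrable0.
  by under eq_Rintegral do rewrite big_nil; rewrite Rintegral_cst ?mul0r.
have E : (fun u => \sum_(j <- i :: r) F j u) = (fun u => F i u + \sum_(j <- r) F j u).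
  by apply/funext => u; rewrite big_cons.
split; last by rewrite E RintegralD // IH2 big_cons.
under eq_fun do rewrite big_cons.
by have := integrableD measurableT (iF i) IH1.
Qed.

(** * Cone transforms *)

Section cone.
Context {R : realType} {m : nat}.
Local Notation RT := (measurableTypeR R).
Local Notation mu := (@lebesgue_tuple R m).
Local Notation spacetime := ('rV[R]_m * R)%type.
Implicit Types (f g w : spacetime -> R) (p q v : spacetime) (ker : m.-tuple RT -> R).

Definition cone ker w : spacetime -> R := superpose mu (fun=> 1) row_of_tuple tnorm ker w.

Definition cone_admissible ker := admissible mu (fun=> 1) (@row_of_tuple R m) tnorm ker.

Lemma coneE ker w p :
  cone ker w p = \int[mu]_u (ker u * w (p.1 + row_of_tuple u, p.2 + tnorm u)).
Proof. by apply: eq_Rintegral => u _; rewrite /displace scale1r. Qed.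

(** The case [l = 1] is the cone itself; the other values give the dilated integrals that
    [cone_scaling] differentiates in [l]. *)
Lemma admissible_scaled ker (l : R) : 0 < l -> measurable_fun setT ker ->
  (forall M, mu.-integrable [set u | tnorm u <= M] (EFin \o ker)) ->
  admissible mu (fun=> 1) (fun u => l *: row_of_tuple u) (fun u => l * tnorm u) ker.
Proof.
move=> l0 mk ik; split => //.
- move=> i; under eq_fun do rewrite mxE.
  by apply: measurable_funM => //; exact: measurable_row_of_tuple.
- by apply: measurable_funM => //; exact: measurable_tnorm.
- move=> M; have -> : [set u : m.-tuple RT | l * tnorm u <= M] = [set u | tnorm u <= M / l].
    by apply/seteqP; split=> u /=; rewrite ler_pdivlMr // mulrC.
  exact: ik.
- by move=> u _; rewrite mulr_ge0 ?eucl_norm_ge0 // ltW.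
- move=> M; exists (1 + `|M|) => u _ uM; rewrite normr1 lerDl normr_ge0; split => //.
  rewrite normrZ (le_trans (y := M)) //.
    by apply: le_trans uM; rewrite gtr0_norm // ler_pM2l // norm_eucl_norm.
  by rewrite (le_trans (ler_norm M)) // lerDr.
Qed.

Lemma cone_admissible_int ker : measurable_fun setT ker ->
  (forall M, mu.-integrable [set u | tnorm u <= M] (EFin \o ker)) -> cone_admissible ker.
Proof.
move=> mk ik; have := admissible_scaled ltr01 mk ik.
rewrite /cone_admissible (_ : (fun u => 1 *: row_of_tuple u) = @row_of_tuple R m); last first.
  by apply/funext => u; rewrite scale1r.
by rewrite (_ : (fun u => 1 * tnorm u) = tnorm) //; apply/funext => u; rewrite mul1r.
Qed.

Lemma integrable_bounded ker (C : R) (A : set (m.-tuple RT)) : measurable A ->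
  (mu A < +oo)%E -> measurable_fun A ker -> (forall u, A u -> `|ker u| <= C) ->
  mu.-integrable A (EFin \o ker).
Proof.
move=> mA Aoo mk kC; apply: measurable_bounded_integrable => //.
exists C; split=> [|x Cx u Au]; first exact: num_real.
exact: le_trans (kC u Au) (ltW Cx).
Qed.

Lemma tnorm_le_fin (M : R) : (mu [set u | (tnorm u <= M)%R] < +oo)%E.
Proof.
apply: (le_lt_trans _ (lebesgue_tuple_tnorm_fin (M + 1))); apply: le_measure; rewrite ?inE.
- exact: measurable_tnorm_le.
- exact: measurable_tnorm_lt.
- by move=> u /= uM; rewrite (le_lt_trans uM) // ltrDl.
Qed.

Lemma cone_admissible_bounded ker : measurable_fun setT ker -> (forall u, `|ker u| <= 1) ->
  cone_admissible ker.
Proof.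
move=> mk k1; apply: cone_admissible_int => // M; apply: (@integrable_bounded _ 1).
- exact: measurable_tnorm_le.
- exact: tnorm_le_fin.
- exact: measurable_funTS.
- by move=> u _.
Qed.

(** The kernels of [B0], [B1] and [R_i], in this order. At the origin [ker_inv] and [ker_dir] are
    0. *)
Definition ker1 : m.-tuple RT -> R := fun=> 1.
Definition ker_inv : m.-tuple RT -> R := fun u => (tnorm u)^-1.
Definition ker_dir (i : 'I_m) : m.-tuple RT -> R := fun u => tnth u i / tnorm u.

Lemma measurable_ker_inv : measurable_fun setT ker_inv.
Proof. by apply: measurableT_comp; [exact: measurable_invr|exact: measurable_tnorm]. Qed.

Lemma norm_ker_dir i u : `|ker_dir i u| <= 1.
Proof.
have := coord_eucl_norm (row_of_tuple u) i; rewrite mxE -/(tnorm u).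
have := eucl_norm_ge0 (row_of_tuple u); rewrite -/(tnorm u) /ker_dir.
rewrite le_eqVlt => /predU1P[<-|r0 ur]; first by rewrite invr0 mulr0 normr0.
by rewrite normrM normfV (gtr0_norm r0) ler_pdivrMr // mul1r.
Qed.

Lemma adm1 : cone_admissible ker1.
Proof. by apply: cone_admissible_bounded => [|u]; rewrite /ker1 ?normr1. Qed.

Lemma adm_dir i : cone_admissible (ker_dir i).
Proof.
apply: cone_admissible_bounded (norm_ker_dir i).
by apply: measurable_funM; [exact: measurable_tnth|exact: measurable_ker_inv].
Qed.

Lemma adm_inv : (1 < m)%N -> cone_admissible ker_inv.
Proof.
move=> m1; apply: cone_admissible_int; first exact: measurable_ker_inv.
by move=> M; exact: integrable_inv_tnorm.
Qed.

Lemma past_smooth_cone ker w : cone_admissible ker -> past_smooth w -> past_smooth (cone ker w).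
Proof. exact: past_smooth_superpose. Qed.

Lemma pd_cone ker w j : cone_admissible ker -> past_smooth w ->
  pd j (cone ker w) = cone ker (pd j w).
Proof.
move=> a sw; rewrite /cone pd_superpose //; congr superpose.
by apply/funext => u; case: j => [i|]; rewrite /dil_factor mulr1.
Qed.

Lemma coneD ker f g : cone_admissible ker -> past_smooth f -> past_smooth g ->
  cone ker (f + g) = cone ker f + cone ker g.
Proof. exact: superposeD. Qed.

Lemma coneZ ker (c : R) f : cone_admissible ker -> past_smooth f ->
  cone ker (c *: f) = c *: cone ker f.
Proof. exact: superposeZ. Qed.

Lemma cone_sum ker (I : Type) (r : seq I) (F : I -> spacetime -> R) :
  cone_admissible ker -> (forall i, past_smooth (F i)) ->
  cone ker (\sum_(i <- r) F i) = \sum_(i <- r) cone ker (F i).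
Proof. exact: superpose_sum. Qed.

Lemma box_cone ker w : cone_admissible ker -> past_smooth w ->
  box (cone ker w) = cone ker (box w).
Proof.
move=> a sw; have sp j : past_smooth (pd j w) by exact: past_smooth_pd.
have sp2 i j : past_smooth (pd i (pd j w)) by exact: past_smooth_pd.
have E j : pd j (pd j (cone ker w)) = cone ker (pd j (pd j w)) by rewrite !pd_cone.
rewrite !boxE coneD ?coneZ ?cone_sum //; last 2 first.
- by apply: past_smooth_sum.
- by apply: past_smoothZ; exact: past_smooth_sum.
by rewrite E; congr (_ + _ *: _); apply: eq_bigr => i _; exact: E.
Qed.

Lemma past_cone_bound w p : continuous w -> past_supported w -> exists C M : R,
  [/\ 0 <= C, 0 <= M, forall x s, `|x| <= s -> `|w (p.1 + x, p.2 + s)| <= C &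
      forall x s, M < s -> w (p.1 + x, p.2 + s) = 0].
Proof.
move=> cw [t0 wt]; pose M := Num.max 0 (t0 - p.2).
have M0 : 0 <= M by rewrite le_max lexx.
have z x s : M < s -> w (p.1 + x, p.2 + s) = 0.
  by rewrite gt_max => /andP[_ sM]; apply: wt => /=; lra.
have [C C0 HC] := continuous_bounded (`|p| + M) cw.
exists C, M; split=> // x s xs; have [sM|sM] := leP s M; last by rewrite z // normr0.
have /andP[p1 p2] : (`|p.1| <= `|p|) && (`|p.2| <= `|p|) by rewrite -norm_le.
apply: HC; rewrite norm_le /=; apply/andP; split; rewrite (le_trans (ler_normD _ _)) // lerD //.
  exact: le_trans xs sM.
by rewrite ger0_norm // (le_trans _ xs).
Qed.

Lemma cone_integrable ker w p : cone_admissible ker -> continuous w -> past_supported w ->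
  mu.-integrable setT (fun u => (ker u * w (p.1 + row_of_tuple u, p.2 + tnorm u))%:E).
Proof.
move=> a cw pw; have := superpose_integrable p a cw pw.
by apply: eq_integrable => // u _; rewrite /displace scale1r.
Qed.

(** The integrand of the double integral depends on the two cone vectors through the product of the
    kernels and the sum of the displacements. The integrals may be exchanged: both lengths are
    nonnegative, so if one of them exceeds [M], their sum does and [w] vanishes. *)
Lemma cone_comm k1 k2 w : cone_admissible k1 -> cone_admissible k2 -> past_smooth w ->
  cone k1 (cone k2 w) = cone k2 (cone k1 w).
Proof.
move=> a1 a2 [sw pw]; apply/funext => p.
have cw := Cinf_continuous sw.
have [C [M [C0 M0 HC Hz]]] := past_cone_bound p cw pw.
pose f k k' (z : m.-tuple RT * m.-tuple RT) := k z.1 * (k' z.2 *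
  w (p.1 + (row_of_tuple z.1 + row_of_tuple z.2), p.2 + (tnorm z.1 + tnorm z.2))).
have E k k' : cone_admissible k' -> cone k (cone k' w) p = \int[mu]_y \int[mu]_z f k k' (y, z).
  move=> a'; rewrite coneE; apply: eq_Rintegral => y _; rewrite coneE /= /f /=.
  rewrite -RintegralZl //; last exact: (cone_integrable (p.1 + row_of_tuple y, p.2 + tnorm y)).
  by apply: eq_Rintegral => z _; rewrite !addrA.
rewrite (E k1 k2 a2) (E k2 k1 a1).
pose S := [set u : m.-tuple RT | tnorm u <= M].
have mS : measurable S := measurable_tnorm_le M.
pose G (k : m.-tuple RT -> R) u := `|k u| * \1_S u.
have iG k : cone_admissible k -> mu.-integrable setT (EFin \o G k).
  move=> a; have : mu.-integrable setT ((fun y => `|(k y)%:E|%E) \_ S).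
    by apply/(integrable_mkcond _ mS); apply: integrable_abse; exact: adm_int a M.
  apply: eq_integrable => // y _; rewrite /= /G !EFinM /patch indicE.
  by case: ifP => _; rewrite ?mule1 ?mule0.
rewrite (@Rintegral_exchange _ _ _ _ _ mu mu (f k1 k2) (fun u => C * G k1 u) (G k2)).
- apply: eq_Rintegral => z _; apply: eq_Rintegral => y _; rewrite /f /= mulrCA.
  by rewrite (addrC (row_of_tuple y)) (addrC (tnorm y)).
- apply: measurable_funM.
    by apply: measurableT_comp; [exact: adm_ker a1|exact: measurable_fst].
  apply: measurable_funM.
    by apply: measurableT_comp; [exact: adm_ker a2|exact: measurable_snd].
  apply: measurable_continuous cw => [i|].
    under eq_fun do rewrite !mxE; apply: measurable_funD => //; apply: measurable_funD.
      exact: (measurableT_comp (measurable_tnth i) measurable_fst).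
    exact: (measurableT_comp (measurable_tnth i) measurable_snd).
  apply: measurable_funD => //; apply: measurable_funD.
    by apply: measurableT_comp; [exact: measurable_tnorm|exact: measurable_fst].
  by apply: measurableT_comp; [exact: measurable_tnorm|exact: measurable_snd].
- rewrite (_ : _ \o _ = (fun u => C%:E * (EFin \o G k1) u)%E); last by apply/funext => u; rewrite /= EFinM.
  by apply: integrableZl => //; exact: iG.
- exact: iG.
move=> y z; rewrite /f /G /= !indicE.
have y0 := eucl_norm_ge0 (row_of_tuple y); have z0 := eucl_norm_ge0 (row_of_tuple z).
have [yS|yS] := leP (tnorm y) M; last first.
  rewrite Hz ?mulr0 ?normr0 ?mulr_ge0 // (lt_le_trans yS) // lerDl; exact: z0.
have [zS|zS] := leP (tnorm z) M; last first.
  rewrite Hz ?mulr0 ?normr0 ?mulr_ge0 // (lt_le_trans zS) // lerDr; exact: y0.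
rewrite !mem_set // !mulr1 !normrM.
rewrite (_ : C * `|k1 y| * `|k2 z| = `|k1 y| * (`|k2 z| * C)); last by ring.
do 2 apply: ler_wpM2l => //.
apply: HC; rewrite (le_trans (ler_normD _ _)) // lerD //; exact: norm_eucl_norm.
Qed.

Lemma big_option (F : option 'I_m -> R) : \sum_j F j = F None + \sum_(i < m) F (Some i).
Proof.
rewrite (bigD1 None) //=; congr (_ + _).
rewrite (reindex_omap Some id) /=; last by case.
by apply: eq_bigl => i; rewrite eqxx.
Qed.

(** A whole hyperplane is removed and not only the apex: a translation in another direction keeps
    [u_j], so the norm stays positive for all values of the parameter at once. *)
Definition off_hyperplane (j : 'I_m) : set (m.-tuple RT) := setT `\` [set u | tnth u j = 0].

Lemma measurable_off_hyperplane j : measurable (off_hyperplane j).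
Proof.
apply: measurableD => //; exact: (measurable_coord_slice j (measurable_set1 (0 : R))).
Qed.

Lemma tnorm_gt0 j u : off_hyperplane j u -> 0 < tnorm u.
Proof. by move=> [_ /= uj]; apply: (@eucl_norm_gt0 _ _ _ j); rewrite mxE; exact/eqP. Qed.

Lemma Rintegral_off_hyperplane j (h : m.-tuple RT -> R) : mu.-integrable setT (EFin \o h) ->
  \int[mu]_u h u = \int[mu]_(u in off_hyperplane j) h u.
Proof.
move=> ih; rewrite /Rintegral; congr fine; apply: negligible_integral => //.
  exact: (measurable_coord_slice j (measurable_set1 (0 : R))).
exact: lebesgue_tuple_hyperplane.
Qed.

Lemma is_derive_integral (D : set (m.-tuple RT)) (f df : R -> m.-tuple RT -> R)
    (G : m.-tuple RT -> R) (a l r : R) : measurable D -> l < a < r ->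
  (forall x, l < x < r -> mu.-integrable D (EFin \o f x)) ->
  (forall x u, l < x < r -> D u -> is_derive x 1 (f ^~ u) (df x u)) ->
  (forall u, 0 <= G u) -> mu.-integrable D (EFin \o G) ->
  (forall x u, l < x < r -> D u -> `|df x u| <= G u) ->
  is_derive a 1 (fun x => \int[mu]_(u in D) f x u) (\int[mu]_(u in D) df a u).
Proof.
move=> mD lar intf dfd G0 iG dfG.
have I x : `]l, r[%classic x -> l < x < r by rewrite /= in_itv.
have Ia : `]l, r[%classic a by rewrite /= in_itv.
have D1 x u : `]l, r[%classic x -> D u -> partial1of2 f x u = df x u.
  by move=> /I xI Du; rewrite partial1of2E; have [] := dfd x u xI Du.
have L : h^-1 *: (\int[mu]_(u in D) f (h + a) u - \int[mu]_(u in D) f a u) @[h --> 0^'] -->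
    \int[mu]_(u in D) df a u.
  have := @cvg_differentiation_under_integral R _ _ mu f D mD a l r Ia
    (fun x xI => intf x (I x xI)) _ G G0 iG _.
  rewrite (_ : \int[mu]_(y in D) partial1of2 f a y = \int[mu]_(u in D) df a u); last first.
    by apply: eq_Rintegral => u /set_mem Du; exact: D1.
  apply.
    by move=> x u /I xI Du; have [] := dfd x u xI Du.
  by move=> x u xI Du; rewrite D1 //; apply: dfG => //; exact: I.
have L' : h^-1 *: (((fun x => \int[mu]_(u in D) f x u) \o shift a) (h *: 1) - \int[mu]_(u in D) f a u)
    @[h --> 0^'] --> \int[mu]_(u in D) df a u.
  by under eq_fun do rewrite /= [_ *: 1]mulr1.
by apply: DeriveDef; [apply/cvg_ex; eexists; exact: L'|exact: cvg_lim L'].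
Qed.

Definition cube (r : R) : set (m.-tuple RT) := [set u | forall j, `|tnth u j| < r].

Lemma cube_fin (r : R) : (mu (cube r) < +oo)%E.
Proof.
have fin s : 0 < s -> (mu (cube s) < +oo)%E.
  by move=> s0; rewrite /cube lebesgue_tuple_cube // ltry.
have [r0|r0] := ltP 0 r; first exact: fin.
apply: (le_lt_trans _ (fin 1 ltr01)); apply: le_measure; rewrite ?inE.
- exact: measurable_cube.
- exact: measurable_cube.
- by move=> u h j; rewrite (lt_le_trans (h j)) // (le_trans r0).
Qed.

Lemma integrable_cube (C r : R) : mu.-integrable setT (fun u => (C * \1_(cube r) u)%:E).
Proof.
rewrite (_ : (fun u => _) = (fun u => C%:E * (EFin \o \1_(cube r)) u)%E); last first.
  by apply/funext => u; rewrite EFinM.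
have mC : measurable (cube r) by exact: measurable_cube.
apply: integrableZl => //; apply/integrableP; split; first exact/measurable_EFinP.
under eq_integral => u _ do rewrite gee0_abs ?lee_fin //.
rewrite integral_indic // setIT.
exact: cube_fin.
Qed.

Lemma eucl_norm_is_derive (x : R -> 'rV[R]_m) (x' : 'I_m -> R) (s : R) :
  (forall i, is_derive s 1 (fun h => x h ord0 i) (x' i)) -> 0 < eucl_norm (x s) ->
  is_derive s 1 (fun h => eucl_norm (x h)) ((\sum_i x s ord0 i * x' i) / eucl_norm (x s)).
Proof.
move=> dx xs0; pose S h := \sum_(i < m) x h ord0 i ^+ 2.
have Ss : 0 < S s by rewrite /S -sqr_eucl_norm exprn_gt0.
have dS : is_derive s 1 S (2 * \sum_i x s ord0 i * x' i).
  have -> : S = \sum_(i < m) (fun h => x h ord0 i) ^+ 2.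
    by apply/funext => h; rewrite /S fct_sumE; apply: eq_bigr => i _; rewrite !expr2.
  apply: is_derive_eq; rewrite mulr_sumr; apply: eq_bigr => i _.
  by rewrite -[_ *: _]/(_ * _) expr1 -mulr_natl mulrA.
have := is_derive1_comp (is_derive1_sqrt Ss) dS.
rewrite (_ : Num.sqrt \o S = fun h => eucl_norm (x h)) // -/(eucl_norm (x s)).
by move=> H; apply: (is_derive_eq H); field; rewrite gt_eqF.
Qed.

(* Differentiate [e |-> \int w (x + u + e e_i, t + |u + e e_i|) du], which is
   constant; off the null hyperplane [u_j = 0], [j != i], the norm is smooth. *)
Lemma cone_translation i w : (1 < m)%N -> past_smooth w ->
  cone ker1 (pd (Some i) w) + cone (ker_dir i) (pd None w) = 0.
Proof.
move=> m1 sw; have [j ji] : exists j : 'I_m, j != i.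
  have [/eqP i0|i0] := boolP (val i == 0%N); last first.
    by exists (Ordinal (ltnW m1)); apply: contra i0 => /eqP <-.
  by exists (Ordinal m1); apply/eqP => /(congr1 val); rewrite /= i0.
have [csw pw] := sw; have cw := Cinf_continuous csw.
have [ci pi] := past_smooth_pd (Some i) sw; have [ct pt] := past_smooth_pd None sw.
apply/funext => p.
have [C [M [C0 M0 HC Hz]]] := past_cone_bound p cw pw.
have [Ci [Mi [Ci0 Mi0 HCi Hzi]]] := past_cone_bound p (Cinf_continuous ci) pi.
have [Ct [Mt [Ct0 Mt0 HCt Hzt]]] := past_cone_bound p (Cinf_continuous ct) pt.
pose y (e : R) u : 'rV[R]_m := row_of_tuple u + e *: delta_mx ord0 i.
pose gam e u : spacetime := (p.1 + y e u, p.2 + eucl_norm (y e u)).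
have yl e u k : y e u ord0 k = tnth u k + e * (k == i)%:R by rewrite !mxE eqxx.
(* Outside such a cube the translated cone vector is so long that [w] and its derivatives vanish;
   multiples of indicators of cubes thus serve as majorants. *)
have far N e u : ~ cube (N + 1 + `|e|) u -> N < eucl_norm (y e u).
  move=> nK; rewrite ltNge; apply/negP => yN; apply: nK => k.
  have := le_trans (coord_eucl_norm (y e u) k) yN; rewrite yl => h.
  have := ler_normB (tnth u k + e * (k == i)%:R) (e * (k == i)%:R); rewrite addrK => h2.
  have h3 : `|e * (k == i)%:R| <= `|e| by rewrite normrM normr_nat; case: (k == i); rewrite ?mulr1 ?mulr0.
  by lra.
pose h u := w (p.1 + row_of_tuple u, p.2 + tnorm u).
have mh : measurable_fun setT h.
  apply: measurable_continuous cw => [k|].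
    under eq_fun do rewrite !mxE; apply: measurable_funD => //; exact: measurable_tnth.
  by apply: measurable_funD => //; exact: measurable_tnorm.
have fE e u : w (gam e u) = h (affine_tuple 1 (tuple_of_row (e *: delta_mx ord0 i)) u).
  by rewrite /h /tnorm row_of_affine_tuple tuple_of_rowK scale1r.
have intf e : mu.-integrable setT (fun u => (w (gam e u))%:E).
  apply: (le_integrable measurableT _ _ (integrable_cube C (M + 1 + `|e|))).
    apply/measurable_EFinP; under eq_fun do rewrite fE.
    by apply: measurableT_comp => //; exact: measurable_affine_tuple.
  move=> u _; rewrite lee_fin indicE; case: (pselect (cube (M + 1 + `|e|) u)) => uK.
    by rewrite mem_set // mulr1 (ger0_norm C0) HC // norm_eucl_norm.
  by rewrite Hz ?normr0 //; exact: far.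
have mD := measurable_off_hyperplane j.
pose df e u := pd (Some i) w (gam e u) + (tnth u i + e) / eucl_norm (y e u) * pd None w (gam e u).
have dF : is_derive (0 : R) 1 (fun e => \int[mu]_(u in off_hyperplane j) w (gam e u))
    (\int[mu]_(u in off_hyperplane j) df 0 u).
  apply: (@is_derive_integral _ _ _ (fun u =>
    Ci * \1_(cube (Mi + 1 + 1)) u + Ct * \1_(cube (Mt + 1 + 1)) u) 0 (-1) 1) => //.
  - by rewrite ltrN10 ltr01.
  - by move=> e _; apply: integrableS (intf e).
  - move=> e u _ uD.
    have ypos : 0 < eucl_norm (y e u).
      apply: (@eucl_norm_gt0 _ _ _ j); rewrite yl (negbTE ji) mulr0 addr0.
      by case: uD => _ /eqP.
    pose c (k : option 'I_m) : R := if k is Some k then (k == i)%:R else (tnth u i + e) / eucl_norm (y e u).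
    have dy k : is_derive e 1 (fun e => y e u ord0 k) (k == i)%:R.
      by under eq_fun do rewrite yl; exact: affine_is_derive.
    have dc k : is_derive e 1 (fun e => stcoord k (gam e u)) (c k).
      case: k => [k|] /=.
        rewrite (_ : (fun e => _) = cst (p.1 ord0 k) + (fun e => y e u ord0 k)); last first.
          by apply/funext => e'; rewrite mxE.
        by apply: is_derive_eq; rewrite add0r.
      have dn := eucl_norm_is_derive dy ypos.
      rewrite (_ : (fun e => _) = cst p.2 + (fun e => eucl_norm (y e u))) //.
      apply: is_derive_eq; rewrite add0r (bigD1 i) //= big1 => [|k ki]; last by rewrite (negbTE ki) mulr0.
      by rewrite eqxx mulr1 addr0 yl eqxx mulr1.
    have H := chain_rule (Cinf_c1 csw) dc; apply: (is_derive_eq H).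
    rewrite big_option /= (bigD1 i) //= big1 => [|k ki]; last by rewrite (negbTE ki) mul0r.
    by rewrite eqxx mul1r addr0 addrC /df pd.unlock.
  - by move=> u; rewrite addr_ge0 // mulr_ge0.
  - apply: (integrableS measurableT) => //.
    by have := integrableD measurableT (integrable_cube Ci (Mi + 1 + 1)) (integrable_cube Ct (Mt + 1 + 1)).
  - move=> e u e1 uD; have {}e1 : `|e| < 1 by rewrite ltr_norml.
    have ypos : 0 < eucl_norm (y e u).
      apply: (@eucl_norm_gt0 _ _ _ j); rewrite yl (negbTE ji) mulr0 addr0.
      by case: uD => _ /eqP.
    have sub N : cube (N + 1 + `|e|) `<=` cube (N + 1 + 1).
      by move=> v hv k; rewrite (lt_trans (hv k)) // ltrD2l.
    have r1 : `|(tnth u i + e) / eucl_norm (y e u)| <= 1.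
      rewrite normrM normfV (gtr0_norm ypos) ler_pdivrMr // mul1r.
      by have := coord_eucl_norm (y e u) i; rewrite yl eqxx mulr1.
    rewrite (le_trans (ler_normD _ _)) // lerD //.
      rewrite indicE; case: (pselect (cube (Mi + 1 + `|e|) u)) => uK.
        by rewrite mem_set ?mulr1; [apply: HCi; exact: norm_eucl_norm|exact: sub].
      by rewrite Hzi ?normr0 ?mulr_ge0 //; exact: far.
    rewrite normrM (le_trans (ler_piMl _ r1)) // indicE.
    case: (pselect (cube (Mt + 1 + `|e|) u)) => uK.
      by rewrite mem_set ?mulr1; [apply: HCt; exact: norm_eucl_norm|exact: sub].
    by rewrite Hzt ?normr0 ?mulr_ge0 //; exact: far.
have Fcst : (fun e => \int[mu]_(u in off_hyperplane j) w (gam e u)) = cst (\int[mu]_u h u).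
  apply/funext => e; rewrite -Rintegral_off_hyperplane //; last exact: intf.
  under eq_Rintegral do rewrite fE.
  by rewrite Rintegral_affine_tuple // expr1n invr1 mul1r.
have int0 : \int[mu]_(u in off_hyperplane j) df 0 u = 0.
  by case: dF => _; rewrite Fcst derive_cst => <-.
have E u : df 0 u = ker1 u * pd (Some i) w (p.1 + row_of_tuple u, p.2 + tnorm u) +
    ker_dir i u * pd None w (p.1 + row_of_tuple u, p.2 + tnorm u).
  by rewrite /df /gam /y scale0r !addr0 mul1r.
have I1 := cone_integrable p adm1 (Cinf_continuous ci) pi.
have I2 := cone_integrable p (adm_dir i) (Cinf_continuous ct) pt.
transitivity (\int[mu]_u (ker1 u * pd (Some i) w (p.1 + row_of_tuple u, p.2 + tnorm u) +
    ker_dir i u * pd None w (p.1 + row_of_tuple u, p.2 + tnorm u))).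
  by rewrite RintegralD // -!coneE.
rewrite (Rintegral_off_hyperplane j); last first.
  by have := integrableD measurableT I1 I2.
by rewrite -[RHS]int0; apply: eq_Rintegral => u _; rewrite E.
Qed.

(* Differentiate [l |-> l^m \int w (x + l u, t + l |u|) / |u| du = l B1 w] at
   [l = 1]. *)
Lemma cone_scaling w : (1 < m)%N -> past_smooth w ->
  \sum_(i < m) cone (ker_dir i) (pd (Some i) w) + cone ker1 (pd None w) =
  (1 - m%:R) *: cone ker_inv w.
Proof.
move=> m1 sw; pose j : 'I_m := Ordinal m1.
have [csw pw] := sw; have cw := Cinf_continuous csw.
have sp k : past_smooth (pd k w) := past_smooth_pd k sw.
apply/funext => p.
have /choice[CM CMP] k : exists CM : R * R, [/\ 0 <= CM.1, 0 <= CM.2,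
    forall x s, `|x| <= s -> `|pd k w (p.1 + x, p.2 + s)| <= CM.1 &
    forall x s, CM.2 < s -> pd k w (p.1 + x, p.2 + s) = 0].
  have [ck pk] := sp k.
  by have [C [M ?]] := past_cone_bound p (Cinf_continuous ck) pk; exists (C, M).
pose M := \sum_k (CM k).2.
have MM k : (CM k).2 <= M.
  by rewrite /M (bigD1 k) //= lerDl sumr_ge0 // => i _; have [] := CMP i.
have M0 : 0 <= M by rewrite sumr_ge0 // => i _; have [] := CMP i.
pose gam l u : spacetime := (p.1 + l *: row_of_tuple u, p.2 + l * tnorm u).
pose f l u := ker_inv u * w (gam l u).
have gamE l u : 0 < l -> `|l *: row_of_tuple u| <= l * tnorm u.
  by move=> l0; rewrite normrZ gtr0_norm // ler_pM2l // norm_eucl_norm.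
have intf l : 0 < l -> mu.-integrable setT (EFin \o f l).
  move=> l0; have a := admissible_scaled l0 measurable_ker_inv (fun M => integrable_inv_tnorm M m1).
  have := superpose_integrable p a cw pw.
  by apply: eq_integrable => // u _; rewrite /= /displace scale1r.
have mD := measurable_off_hyperplane j.
pose c (u : m.-tuple RT) (k : option 'I_m) : R := if k is Some k then tnth u k else tnorm u.
pose df l u := ker_inv u * \sum_k c u k * pd k w (gam l u).
have kc u k : `|ker_inv u * c u k| <= 1.
  case: k => [k|] /=; first by rewrite mulrC; exact: norm_ker_dir.
  rewrite /ker_inv; have [->|t0] := eqVneq (tnorm u) 0; first by rewrite mulr0 normr0.
  by rewrite mulVf // normr1.
(* For [l > 1/2] and [u] outside [K] the dilated length [l |u|] exceeds [M]. *)
pose K := cube (2 * M + 1).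
have far l u : 1 / 2 < l -> ~ K u -> M < l * tnorm u.
  move=> l2 nK; rewrite ltNge; apply/negP => lM; apply: nK => k.
  have := coord_eucl_norm (row_of_tuple u) k; rewrite mxE -/(tnorm u) => uk.
  apply: le_lt_trans uk _.
  by have t0 : 0 <= tnorm u := eucl_norm_ge0 _; nra.
have dF : is_derive (1 : R) 1 (fun l => \int[mu]_(u in off_hyperplane j) f l u)
    (\int[mu]_(u in off_hyperplane j) df 1 u).
  apply: (@is_derive_integral _ _ _ (fun u => (\sum_k (CM k).1) * \1_K u) 1 (1 / 2) (3 / 2)) => //.
  - by apply/andP; split; lra.
  - by move=> l /andP[l0 _]; apply: integrableS (intf l _) => //; lra.
  - move=> l u _ uD; apply: is_deriveZ.
    have dc k : is_derive l 1 (fun l => stcoord k (gam l u)) (c u k).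
      case: k => [k|] /=; last exact: affine_is_derive.
      rewrite (_ : (fun l => _) = (fun l => p.1 ord0 k + l * tnth u k)); last first.
        by apply/funext => l'; rewrite !mxE.
      exact: affine_is_derive.
    have H := chain_rule (Cinf_c1 csw) dc; apply: (is_derive_eq H).
    by apply: eq_bigr => k _; rewrite pd.unlock.
  - by move=> u; rewrite mulr_ge0 // sumr_ge0 // => i _; have [] := CMP i.
  - by apply: (integrableS measurableT) => //; exact: integrable_cube.
  - move=> l u /andP[l0 l1] uD; have lp : 0 < l by lra.
    rewrite /df mulr_sumr (le_trans (ler_norm_sum _ _ _)) // indicE mulr_suml.
    apply: ler_sum => k _; have [C0 _ HC Hz] := CMP k; rewrite mulrA.
    case: (pselect (K u)) => uK; last first.
      rewrite /gam Hz ?mulr0 ?normr0 ?mulr_ge0 //.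
      by apply: le_lt_trans (MM k) _; exact: far.
    by rewrite mem_set // mulr1 normrM (le_trans (ler_piMl _ (kc u k))) // HC // gamE.
pose I := cone ker_inv w p.
(* The substitution [u |-> l u] produces [l^(-m)], and the weight [1/|u|] produces the factor
   [l]. *)
have FE l : 0 < l -> \int[mu]_(u in off_hyperplane j) f l u = l * (l ^- m * I).
  move=> l0; rewrite -Rintegral_off_hyperplane; last exact: intf.
  pose h u := ker_inv u * w (p.1 + row_of_tuple u, p.2 + tnorm u).
  have fE u : f l u = l * h (affine_tuple l (tuple_of_row 0) u).
    rewrite /f /h /gam /ker_inv /tnorm row_of_affine_tuple tuple_of_rowK addr0.
    by rewrite eucl_normZ gtr0_norm // invfM !mulrA mulfV ?gt_eqF // mul1r.
  have ih : mu.-integrable setT (EFin \o h) by exact: cone_integrable (adm_inv m1) cw pw.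
  have mh : measurable_fun setT h by apply/measurable_EFinP; exact: measurable_int ih.
  have -> : I = \int[mu]_u h u by exact: coneE.
  rewrite -(Rintegral_affine_tuple (tuple_of_row 0) l0 mh).
  under eq_Rintegral do rewrite fE.
  rewrite RintegralZl //.
  have := intf l l0; rewrite (_ : EFin \o f l =
      fun u => (l%:E * (h (affine_tuple l (tuple_of_row 0) u))%:E)%E); last first.
    by apply/funext => u; rewrite /= fE EFinM.
  move=> /(integrableZl measurableT l^-1); apply: eq_integrable => // u _.
  transitivity (l^-1%:E * (l%:E * (h (affine_tuple l (tuple_of_row 0) u))%:E))%E => //.
  by rewrite -!EFinM mulrA mulVf ?mul1r // gt_eqF.
(* The derivative at 1 is computed twice: here from the linear function [l I], and in [dF2] by the
   product rule. The comparison is [key]. *)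
have dF' : is_derive (1 : R) 1 (fun l => l ^+ m * \int[mu]_(u in off_hyperplane j) f l u) I.
  have near1 : \forall l \near (1 : R), l * I = l ^+ m * \int[mu]_(u in off_hyperplane j) f l u.
    near=> l; have l0 : 0 < l by near: l; exact: lt_nbhsr.
    by rewrite FE // mulrCA [_ ^+ m * _]mulrA mulfV ?mul1r // expf_neq0 // gt_eqF.
  have H : is_derive (1 : R) 1 (fun l => l * I) I.
    have := affine_is_derive 0 I 1; rewrite (_ : (fun h => 0 + h * I) = fun l => l * I) //.
    by apply/funext => l; rewrite add0r.
  exact: (@near_eq_is_derive _ _ _ _ _ _ _ _ near1 H).
have dF2 : is_derive (1 : R) 1 (fun l => l ^+ m * \int[mu]_(u in off_hyperplane j) f l u)
    (\int[mu]_(u in off_hyperplane j) df 1 u + m%:R * I).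
  have H := is_deriveM (is_deriveX m (is_derive_id (1 : R) 1)) dF.
  rewrite (_ : (fun l => _) =
      id ^+ m * (fun l => \int[mu]_(u in off_hyperplane j) f l u)); last first.
    by apply/funext => l; rewrite [RHS]/(_ * _) exprfctE.
  apply: (is_derive_eq H); rewrite exprfctE FE // !expr1n invr1 !mul1r scale1r; congr (_ + _).
  by rewrite /GRing.scale /= !mulr1 mulrC.
have key : \int[mu]_(u in off_hyperplane j) df 1 u = (1 - m%:R) * I.
  case: dF' => _ E1; case: dF2 => _; rewrite E1 => E2.
  by rewrite mulrBl mul1r; apply/esym/eqP; rewrite subr_eq -E2.
pose q k := fun u : m.-tuple RT => ker_inv u * c u k * pd k w (p.1 + row_of_tuple u, p.2 + tnorm u).
have adk k : cone_admissible (fun u => ker_inv u * c u k).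
  apply: cone_admissible_bounded; last by move=> u; exact: kc.
  apply: measurable_funM; first exact: measurable_ker_inv.
  by case: k => [k|]; [exact: measurable_tnth|exact: measurable_tnorm].
have iq k : mu.-integrable setT (EFin \o q k).
  by have [ck pk] := sp k; exact: cone_integrable (adk k) (Cinf_continuous ck) pk.
have [isum Esum] := Rintegral_sum (index_enum (option 'I_m)) iq.
transitivity ((1 - m%:R) * I) => //; rewrite -key.
have -> : \int[mu]_(u in off_hyperplane j) df 1 u = \int[mu]_u \sum_k q k u.
  rewrite (Rintegral_off_hyperplane j isum); apply: eq_Rintegral => u _.
  rewrite /df mulr_sumr; apply: eq_bigr => k _.
  by rewrite /q /gam scale1r mul1r mulrA.
rewrite Esum big_option addrC fctE fct_sumE; congr (_ + _).
  rewrite coneE (Rintegral_off_hyperplane j); last first.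
    by have [ck pk] := sp None; exact: cone_integrable adm1 (Cinf_continuous ck) pk.
  rewrite (Rintegral_off_hyperplane j (iq None)); apply: eq_Rintegral => u /set_mem uD.
  by rewrite /q /= /ker_inv mulVf // gt_eqF // (tnorm_gt0 uD).
apply: eq_bigr => k _; rewrite coneE; apply: eq_Rintegral => u _.
by rewrite /q /= /ker_dir [_ / _]mulrC.
Unshelve. all: by end_near. Qed.

End cone.

(** * Integration in time *)

Section one_variable.
Context {R : realType}.
Local Notation RT := (measurableTypeR R).
Local Notation lam := (@lebesgue_measure R).

Lemma Rintegral_FTC2 (f F : R -> R) (a b : R) : a < b -> continuous f ->
  (forall x : R, is_derive x 1 F (f x)) -> \int[lam]_(x in `[a, b]) f x = F b - F a.
Proof.
move=> ab cf dF; have cF : continuous F.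
  by move=> x; apply: differentiable_continuous; apply/derivable1_diffP; apply: ex_derive.
rewrite /Rintegral (@continuous_FTC2 _ f F) //.
- exact: continuous_subspaceT.
- split=> [x _||]; first exact: ex_derive.
  + by apply: cvg_at_right_filter; exact: cF.
  + by apply: cvg_at_left_filter; exact: cF.
- by move=> x _; rewrite derive1E derive_val.
Qed.

Lemma Rintegral_tail (f F : R -> R) (a N : R) : continuous f ->
  (forall x : R, is_derive x 1 F (f x)) -> (forall x, N <= x -> f x = 0 /\ F x = 0) ->
  \int[lam]_x ((a < x)%R%:R * f x) = - F a.
Proof.
(* The term [a + 1] ensures [a < b] when [N] lies to the left of [a]. *)
move=> cf dF fN; pose b := Num.max (a + 1) N.
have ab : a < b by rewrite lt_max ltrDl ltr01.
have Nb : N <= b by rewrite le_max lexx orbT.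
have <- : \int[lam]_(x in `[a, b]) f x = - F a.
  by rewrite (Rintegral_FTC2 ab cf dF) (fN b Nb).2 sub0r.
have icf : lam.-integrable `[a, b] (EFin \o f).
  by apply: continuous_compact_integrable; [exact: segment_compact|exact: continuous_subspaceT].
rewrite -Rintegral_itv_obnd_cbnd; last first.
  by apply: integrableS icf => //; exact: subset_itv_oc_cc.
rewrite [RHS]Rintegral_mkcond; apply: eq_Rintegral => x _; rewrite /patch.
case: ifPn => [|/negP xab].
  by rewrite inE /= in_itv /= => /andP[-> _]; rewrite mul1r.
have [ax|] := ltP a x; last by rewrite mul0r.
rewrite (fN x _).1 ?mulr0 // (le_trans Nb) // leNgt; apply/negP => xb.
by apply: xab; rewrite inE /= in_itv /= ax ltW.
Qed.

Lemma Rintegral_dom_integrable (f : RT -> R) (C N : R) : measurable_fun setT f ->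
  (forall s, `|f s| <= C * \1_(`[0, N]%classic : set R) s) -> lam.-integrable setT (EFin \o f).
Proof.
move=> mf fC.
have i1 : lam.-integrable setT (EFin \o (\1_(`[0, N]%classic : set RT) : RT -> R)).
  apply/integrableP; split; first exact/measurable_EFinP.
  under eq_integral => u _ do rewrite gee0_abs ?lee_fin //.
  rewrite integral_indic // setIT.
  apply: (@le_lt_trans _ _ (lebesgue_measure (`[0, N]%classic : set R))) => //.
  rewrite lebesgue_measure_itv /=; by case: ifP => // _; rewrite -EFinB ltry.
apply: (le_integrable measurableT _ _ (integrableZl measurableT C i1)).
- exact/measurable_EFinP.
- by move=> s _; rewrite /= lee_fin (le_trans (fC s)) // ler_norm.
Qed.

End one_variable.

Section time_integral.
Context {R : realType} {m : nat}.
Local Notation RT := (measurableTypeR R).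
Local Notation lam := (@lebesgue_measure R).
Local Notation spacetime := ('rV[R]_m * R)%type.
Implicit Types (f g w : spacetime -> R) (p q v : spacetime).

Definition ker_pow n (s : RT) : R := (0 < s)%R%:R * s ^+ n.

Lemma measurable_ker_pow n : measurable_fun setT (ker_pow n).
Proof.
rewrite (_ : ker_pow n = fun s => if 0 < s then s ^+ n else 0); last first.
  by apply/funext => s; rewrite /ker_pow; case: ifP => _; rewrite ?mul1r ?mul0r.
apply: measurable_fun_ifT => //; exact: measurable_fun_ltr.
Qed.

(** Up to the factor [(-1)^(n+1) n!], this is the [(n+1)]-fold antiderivative in time that vanishes
    for late times ([tail_integral_iter]). *)
Definition tail_integral n w : spacetime -> R :=
  superpose lam (fun=> 1) (fun=> 0) id (ker_pow n) w.

Lemma adm_pow n : admissible lam (fun=> 1) (fun=> 0 : 'rV[R]_m) id (ker_pow n).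
Proof.
split => //.
- exact: measurable_ker_pow.
- move=> M; have mM : measurable [set y : RT | y <= M].
    by have -> : [set y : RT | y <= M] = `]-oo, M]%classic by apply/seteqP; split=> y; rewrite /= in_itv.
  apply/(integrable_mkcond _ mM).
  rewrite (_ : _ \_ _ = EFin \o (fun s => if s <= M then ker_pow n s else 0)); last first.
    apply/funext => s; rewrite /patch /=; case: ifPn => [|/negP sM]; first by rewrite inE => /= ->.
    by case: ifPn => // h; case: sM; rewrite inE.
  apply: (@Rintegral_dom_integrable _ _ (`|M| ^+ n) M).
    by apply: measurable_fun_ifT => //; [exact: measurable_fun_ler|exact: measurable_ker_pow].
  move=> s; rewrite indicE /ker_pow; case: ifPn => sM; last by rewrite normr0 mulr_ge0 // exprn_ge0.
  have [s0|s0] := ltP 0 s; last by rewrite mul0r normr0 mulr_ge0 // exprn_ge0.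
  rewrite mem_set ?mulr1 ?mul1r /=; last by rewrite in_itv /= ltW.
  have M0 : 0 <= M := le_trans (ltW s0) sM.
  by rewrite normrX lerXn2r ?nnegrE // (ger0_norm M0) (ger0_norm (ltW s0)).
- by move=> s; rewrite /ker_pow; have [/ltW//|] := ltP 0 s; rewrite mul0r eqxx.
- move=> M; exists 1 => s _ _; rewrite normr1 normr0; split => //.
Qed.

Lemma tail_integralE n w p :
  tail_integral n w p = \int[lam]_s (ker_pow n s * w (p.1, p.2 + s)).
Proof. by apply: eq_Rintegral => s _; rewrite /displace scale1r addr0. Qed.

Lemma past_smooth_tail n w : past_smooth w -> past_smooth (tail_integral n w).
Proof. by move=> sw; apply: past_smooth_superpose => //; exact: adm_pow. Qed.

Lemma pd_tail n w j : past_smooth w -> pd j (tail_integral n w) = tail_integral n (pd j w).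
Proof.
move=> sw; rewrite /tail_integral pd_superpose //; last exact: adm_pow.
congr superpose; by apply/funext => u; case: j => [i|]; rewrite /dil_factor mulr1.
Qed.

Lemma time_is_derive w p (s : R) : Cinf w ->
  is_derive s 1 (fun s => w (p.1, p.2 + s)) (pd None w (p.1, p.2 + s)).
Proof.
move=> sw; have E (s' : R) : (p.1, p.2 + s') = p + s' *: axis None.
  by apply/pair_eqP; rewrite /= scaler0 addr0 -[_ *: _]/(_ * _) mulr1 !eqxx.
rewrite (_ : (fun s => _) = fun s => w (p + s *: axis None)); last by apply/funext => s'; rewrite -E.
by rewrite E; apply: line_is_derive; rewrite pdE; apply: derivableP; exact: Cinf_derivable.
Qed.

Lemma time_continuous w p : continuous w -> continuous (fun s : R => w (p.1, p.2 + s)).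
Proof.
move=> cw s; have c1 : p.1 @[s' --> s] --> p.1 by exact: cvg_cst.
have c2 : p.2 + s' @[s' --> s] --> p.2 + s by apply: cvgD; [exact: cvg_cst|exact: cvg_id].
apply: (@continuous_comp _ _ _ (fun s' : R => (p.1, p.2 + s')) w s _ (cw _)).
exact: (cvg_pair c1 c2).
Qed.

Lemma tail_integral0_dt w : past_smooth w -> tail_integral 0 (pd None w) = - w.
Proof.
move=> sw; have [csw [t0 wt]] := sw; have [ct [t1 ptt]] := past_smooth_pd None sw.
apply/funext => p; rewrite tail_integralE /ker_pow.
have -> : (- w) p = - w (p.1, p.2 + 0) by rewrite addr0; case: p.
have := @Rintegral_tail _ (fun s => pd None w (p.1, p.2 + s)) (fun s => w (p.1, p.2 + s)) 0
  (Num.max (t0 - p.2) (t1 - p.2) + 1) (time_continuous (Cinf_continuous ct))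
  (fun s => time_is_derive p s csw).
move=> <- => [|s sN]; first by apply: eq_Rintegral => s _; rewrite expr0 mulr1.
have : Num.max (t0 - p.2) (t1 - p.2) < s by apply: lt_le_trans sN; rewrite ltrDl.
by rewrite gt_max => /andP[h0 h1]; split; [apply: ptt|apply: wt] => /=; lra.
Qed.

(** Integration by parts in [s]: the boundary term [s^(n+1) w] vanishes at [s = 0] because of the
    power and for large [s] because of the support. *)
Lemma tail_integralS_dt n w : past_smooth w ->
  tail_integral n.+1 (pd None w) = - n.+1%:R *: tail_integral n w.
Proof.
move=> sw; have [csw pw] := sw; have [t0 wt] := pw.
have [ct pt] := past_smooth_pd None sw; have [t1 ptt] := pt.
apply/funext => p; rewrite fctE !tail_integralE.
pose f s := n.+1%:R * s ^+ n * w (p.1, p.2 + s) + s ^+ n.+1 * pd None w (p.1, p.2 + s).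
pose F s := s ^+ n.+1 * w (p.1, p.2 + s).
have dF (s : R) : is_derive s 1 F (f s).
  have H := is_deriveM (is_deriveX n.+1 (is_derive_id s 1)) (time_is_derive p s csw).
  rewrite (_ : F = id ^+ n.+1 * fun s => w (p.1, p.2 + s)); last first.
    by apply/funext => l; rewrite [RHS]/(_ * _) exprfctE.
  apply: (is_derive_eq H); rewrite exprfctE /f addrC /GRing.scale /= mulr1 mulrC.
  by congr (_ + _); rewrite mulrC.
have cf : continuous f.
  move=> s; apply: cvgD; apply: cvgM.
  - by apply: cvgM; [exact: cvg_cst|exact: exprn_continuous].
  - exact: time_continuous (Cinf_continuous csw) s.
  - exact: exprn_continuous.
  - exact: time_continuous (Cinf_continuous ct) s.
have := @Rintegral_tail _ f F 0 (Num.max (t0 - p.2) (t1 - p.2) + 1) cf dF.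
rewrite /F expr0n /= mul0r oppr0 => H.
have I0 : lam.-integrable setT (EFin \o (fun s => ker_pow n s * w (p.1, p.2 + s))).
  have := superpose_integrable p (adm_pow n) (Cinf_continuous csw) pw.
  by apply: eq_integrable => // s _; rewrite /= /displace scale1r addr0.
have I1 : lam.-integrable setT (EFin \o (fun s => ker_pow n.+1 s * pd None w (p.1, p.2 + s))).
  have := superpose_integrable p (adm_pow n.+1) (Cinf_continuous ct) pt.
  by apply: eq_integrable => // s _; rewrite /= /displace scale1r addr0.
have H2 : \int[lam]_s (n.+1%:R * (ker_pow n s * w (p.1, p.2 + s)) +
    ker_pow n.+1 s * pd None w (p.1, p.2 + s)) = 0.
  rewrite -H => [|s sN].
    by apply: eq_Rintegral => s _; rewrite /ker_pow /f; ring.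
  have : Num.max (t0 - p.2) (t1 - p.2) < s by apply: lt_le_trans sN; rewrite ltrDl.
  rewrite gt_max => /andP[h0 h1].
  by rewrite /f wt ?ptt ?mulr0 ?addr0 //=; lra.
move: H2; rewrite RintegralD //; last first.
  have := integrableZl measurableT n.+1%:R I0; apply: eq_integrable => // s _.
rewrite RintegralZl // => /eqP; rewrite addrC addr_eq0 => /eqP ->.
by rewrite -[_ *: _]/(_ * _) mulNr.
Qed.

Lemma tail_integral_iter n w : past_smooth w ->
  tail_integral n (iter n.+1 (pd None) w) = ((-1) ^+ n.+1 * n`!%:R) *: w.
Proof.
elim: n w => [|n IH] w sw; first by rewrite /= tail_integral0_dt // expr1 mulr1 scaleN1r.
have sP k : past_smooth (iter k (pd None) w) by elim: k => //= k; exact: past_smooth_pd.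
rewrite iterS tail_integralS_dt //.
by rewrite IH // scalerA factS natrM [in RHS]exprS mulN1r !mulNr mulrCA.
Qed.

(** A function that does not depend on time and vanishes for late times is zero. This is the source
    of uniqueness in the range theorem. *)
Lemma dt_inj w : past_smooth w -> pd None w = 0 -> w = 0.
Proof.
move=> sw dw; have := tail_integral0_dt sw.
by rewrite dw /tail_integral superpose0 => /eqP; rewrite eq_sym oppr_eq0 => /eqP.
Qed.

End time_integral.

(** * Wave operator and cone transforms *)

Section cone_box.
Context {R : realType} {m : nat} (m1 : (1 < m)%N).
Local Notation RT := (measurableTypeR R).
Local Notation mu := (@lebesgue_tuple R m).
Local Notation lam := (@lebesgue_measure R).
Local Notation spacetime := ('rV[R]_m * R)%type.
Implicit Types (f g w a : spacetime -> R) (p q v : spacetime).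

Lemma past_smooth_Cinf w : past_smooth w -> Cinf w. Proof. by case. Qed.

Let adm_inv1 : cone_admissible (@ker_inv R m) := adm_inv m1.

Local Ltac ps := solve [eauto 20 using past_smooth_Cinf, past_smooth_pd, past_smooth_cone,
  past_smooth_box, past_smoothZ, past_smoothD, past_smooth_mulcoord, adm1, adm_dir, adm_inv1].

Lemma cone1_pd_space i w : past_smooth w ->
  cone ker1 (pd (Some i) w) = -1 *: cone (ker_dir i) (pd None w).
Proof. by move=> sw; rewrite scaleN1r; apply/eqP; rewrite -addr_eq0 cone_translation. Qed.

(** By [cone1_pd_space] each term [- D_i D_i B0 w] equals [R_i D_i D_t w], so [box B0 w] is the left
    side of [cone_scaling] for [D_t w]. *)
Lemma box_cone1 w : past_smooth w ->
  box (cone ker1 w) = (1 - m%:R) *: cone ker_inv (pd None w).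
Proof.
move=> sw; have st : past_smooth (pd None w) by ps.
rewrite boxE -cone_scaling // !pd_cone; try ps.
rewrite addrC; congr (_ + _); rewrite scaler_sumr; apply: eq_bigr => i _.
rewrite !pd_cone; try ps.
rewrite cone1_pd_space; last by ps.
rewrite scalerA mulN1r opprK scale1r (pdC _ _ (past_smooth_Cinf sw)).
by [].
Qed.

(** After an application of [D_t], translation turns [R_i D_t w] into [- B0 D_i w], to which
    [box_cone1] applies; [dt_inj] then removes [D_t]. *)
Lemma box_cone_dir i w : past_smooth w ->
  box (cone (ker_dir i) w) = (m%:R - 1) *: pd (Some i) (cone ker_inv w).
Proof.
move=> sw; apply/eqP; rewrite -subr_eq0 -scaleN1r; apply/eqP; apply: dt_inj; first by ps.
rewrite pdD ?pdZ; try ps.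
rewrite -box_pd; last by ps.
rewrite pd_cone; try ps.
have -> : cone (ker_dir i) (pd None w) = -1 *: cone ker1 (pd (Some i) w).
  by rewrite cone1_pd_space // scalerA mulN1r opprK scale1r.
rewrite boxZ; last by ps.
rewrite box_cone1; last by ps.
rewrite !pd_cone; try ps.
rewrite (pdC _ _ (past_smooth_Cinf sw)) !scalerA -scalerDl.
have -> : -1 * (1 - m%:R) + -1 * (m%:R - 1) = 0 :> R by ring.
by rewrite scale0r.
Qed.

(** At the displaced point the factor is [(x_i - c) + u_i], and [u_i] times the weight [1/|u|] is
    the kernel of [R_i]. *)
Lemma cone_inv_mulcoord i c w : past_smooth w ->
  cone ker_inv (mulcoord (Some i) c w) =
  mulcoord (Some i) c (cone ker_inv w) + cone (ker_dir i) w.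
Proof.
move=> [sw pw]; have cw := Cinf_continuous sw; apply/funext => p; rewrite fctE /mulcoord !coneE.
have i1 := cone_integrable p adm_inv1 cw pw; have i2 := cone_integrable p (adm_dir i) cw pw.
rewrite -RintegralZl //= -RintegralD //=; last first.
  by have := integrableZl measurableT (p.1 ord0 i - c) i1; apply: eq_integrable.
apply: eq_Rintegral => u _; rewrite /ker_dir /ker_inv !mxE; ring.
Qed.

Lemma past_smooth_iter_box n w : past_smooth w -> past_smooth (iter n box w).
Proof. by move=> sw; elim: n => //= n; exact: past_smooth_box. Qed.

Lemma iter_boxD n f g : past_smooth f -> past_smooth g ->
  iter n box (f + g) = iter n box f + iter n box g.
Proof.
move=> sf sg; elim: n => //= n ->.
by rewrite boxD //; apply: past_smooth_Cinf; exact: past_smooth_iter_box.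
Qed.

Lemma iter_boxZ n c f : past_smooth f -> iter n box (c *: f) = c *: iter n box f.
Proof.
move=> sf; elim: n => //= n ->.
by rewrite boxZ //; apply: past_smooth_Cinf; exact: past_smooth_iter_box.
Qed.

Lemma iter_box_pd n j f : past_smooth f -> iter n box (pd j f) = pd j (iter n box f).
Proof.
move=> sf; elim: n => //= n ->.
by rewrite box_pd //; apply: past_smooth_Cinf; exact: past_smooth_iter_box.
Qed.

Lemma iter_box_cone n ker f : cone_admissible ker -> past_smooth f ->
  iter n box (cone ker f) = cone ker (iter n box f).
Proof.
move=> a sf; elim: n => //= n ->.
by rewrite box_cone //; exact: past_smooth_iter_box.
Qed.

Lemma iter_box_mulcoord n i c f : past_smooth f ->
  iter n.+1 box (mulcoord (Some i) c f) =
  mulcoord (Some i) c (iter n.+1 box f) + (- 2 * n.+1%:R) *: pd (Some i) (iter n box f).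
Proof.
move=> sf; have sn k : past_smooth (iter k box f) by exact: past_smooth_iter_box.
elim: n => [|n IH]; first by rewrite /= box_mulcoord ?mulr1 //; exact: past_smooth_Cinf.
rewrite iterS IH boxD; try by have := sn n; have := sn n.+1; ps.
rewrite box_mulcoord; last by have := sn n.+1; ps.
rewrite boxZ; last by have := sn n; ps.
rewrite box_pd; last by have := sn n; ps.
rewrite -!iterS -addrA -scalerDl; congr (_ + _ *: _).
by rewrite -[n.+2]addn1 natrD; ring.
Qed.

(** * The operator [P] and its commutation with the space coordinates *)

Definition radon_square w : spacetime -> R := iter m.-1 box (cone ker_inv (cone ker_inv w)).

Lemma radon_squareD f g : past_smooth f -> past_smooth g ->
  radon_square (f + g) = radon_square f + radon_square g.
Proof.
by move=> sf sg; rewrite /radon_square !(coneD, iter_boxD); try ps.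
Qed.

Lemma radon_squareZ c f : past_smooth f -> radon_square (c *: f) = c *: radon_square f.
Proof.
by move=> sf; rewrite /radon_square !(coneZ, iter_boxZ); try ps.
Qed.

Lemma radon_square0 : radon_square 0 = 0.
Proof.
have -> : (0 : spacetime -> R) = 0 *: 0 by rewrite scale0r.
by rewrite radon_squareZ ?scale0r //; exact: past_smooth0.
Qed.

Lemma radon_square_sum (I : Type) (r : seq I) (F : I -> spacetime -> R) :
  (forall i, past_smooth (F i)) ->
  radon_square (\sum_(i <- r) F i) = \sum_(i <- r) radon_square (F i).
Proof.
move=> sF; elim: r => [|i r IH]; first by rewrite !big_nil radon_square0.
by rewrite !big_cons radon_squareD ?IH //; exact: past_smooth_sum.
Qed.

(* [box] contributes [- 2 (m - 1) D_i box^(m-2) B1 B1 w], and commuting twice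
   with [B1] contributes [2 box^(m-1) R_i B1 w]: these cancel. *)
Lemma radon_square_mulcoord i c w : past_smooth w ->
  radon_square (mulcoord (Some i) c w) = mulcoord (Some i) c (radon_square w).
Proof.
move=> sw; rewrite /radon_square.
have s1 : past_smooth (cone ker_inv w) by ps.
rewrite cone_inv_mulcoord // coneD; try ps.
rewrite cone_inv_mulcoord // (cone_comm adm_inv1 (adm_dir i) sw).
have mE : m.-1 = m.-2.+1 by case: m m1 => [|[]].
rewrite -addrA iter_boxD; try ps.
rewrite iter_boxD; try ps.
rewrite mE iter_box_mulcoord; last by ps.
rewrite [iter _ box (cone (ker_dir i) _)]iterSr box_cone_dir // iter_boxZ; last by ps.
rewrite iter_box_pd; last by ps.
rewrite -scalerDl -addrA -scalerDl -mE.
rewrite (_ : _ + _ = 0 :> R) ?scale0r ?addr0 //.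
rewrite (_ : m%:R = m.-1%:R + 1); last by rewrite natr1 prednK // (ltnW m1).
ring.
Qed.

(** * Functions of time alone, on which [P] is computed *)

Definition flat a := [/\ past_smooth a, forall i, pd (Some i) a = 0 &
  forall x y t, a (x, t) = a (y, t)].

Lemma flat_pd a : flat a -> flat (pd None a).
Proof.
move=> [sa da ca]; split=> [|i|x y t]; first by ps.
- by rewrite (pdC _ _ (past_smooth_Cinf sa)) da pd0.
rewrite !pdE /derive.
have -> : (fun h : R => h^-1 *: ((a \o shift (x, t)) (h *: axis None) - a (x, t))) =
    fun h => h^-1 *: ((a \o shift (y, t)) (h *: axis None) - a (y, t)); last by [].
by apply/funext => h /=; rewrite (ca (h *: 0 + x) (h *: 0 + y)) (ca x y).
Qed.

Lemma flat_iter_pd n a : flat a -> flat (iter n (pd None) a).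
Proof. by move=> fa; elim: n => //= n; exact: flat_pd. Qed.

(* Layer cake: [a (t + |u|) = - \int 1_(|u| < s) D_t a (t + s) ds], and the ball
   of radius [s] has volume [V s^m]. *)
Lemma cone1_flat a : flat a ->
  cone ker1 a = - @unit_ball_volume R m *: tail_integral m (pd None a).
Proof.
move=> [sa da ca]; have [csa [t0 at0]] := sa; have st : past_smooth (pd None a) by ps.
have [cst pst] := st; have [t1 tt1] := pst.
apply/funext => p; rewrite fctE tail_integralE coneE.
have [C [M [C0 M0 HC Hz]]] := past_cone_bound p (Cinf_continuous cst) pst.
pose b s := pd None a (p.1, p.2 + s).
have cb : continuous b by apply: time_continuous; exact: Cinf_continuous.
have bM (s : R) : 0 <= s -> `|b s| <= C * \1_(`[0, M]%classic : set RT) s.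
  move=> s0; rewrite indicE; case: (boolP (s \in _)) => [_|].
    by rewrite mulr1; have := HC 0 s; rewrite normr0 addr0; exact.
  rewrite notin_setE /= in_itv /= s0 => /negP; rewrite -ltNge => Ms.
  by rewrite mulr0 /b -(addr0 p.1) Hz // normr0.
pose c (u : m.-tuple RT) (s : RT) : R := (tnorm u < s)%R%:R * b s.
have cM u s : `|c u s| <= C * \1_(`[0, M]%classic : set RT) s.
  rewrite /c; have [us|_] := ltP (tnorm u) s; last by rewrite mul0r normr0 mulr_ge0.
  by rewrite mul1r bM // ltW // (le_lt_trans _ us) // eucl_norm_ge0.
have mb : measurable_fun (setT : set RT) b by exact: continuous_measurable_fun.
have mc : measurable_fun setT (fun z : m.-tuple RT * RT => c z.1 z.2).
  rewrite (_ : (fun z => _) = fun z => if tnorm z.1 < z.2 then b z.2 else 0); last first.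
    by apply/funext => z; rewrite /c; case: ifP => _; rewrite ?mul1r ?mul0r.
  apply: measurable_fun_ifT => //; last by apply: measurableT_comp mb _; exact: measurable_snd.
  by apply: measurable_fun_ltr => //; apply: measurableT_comp; [exact: measurable_tnorm|exact: measurable_fst].
have iC : lam.-integrable setT (EFin \o (fun s => C * \1_(`[0, M]%classic : set RT) s)).
  apply: (@Rintegral_dom_integrable _ _ C M); first exact: measurable_funM.
  by move=> s; rewrite ger0_norm // mulr_ge0.
have ic u : lam.-integrable setT (EFin \o c u).
  apply: (@Rintegral_dom_integrable _ _ C M) => //.
  rewrite (_ : c u = fun s => if tnorm u < s then b s else 0); last first.
    by apply/funext => s; rewrite /c; case: ifP => _; rewrite ?mul1r ?mul0r.
  by apply: measurable_fun_ifT => //; exact: measurable_fun_ltr.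
have tailE u : ker1 u * a (p.1 + row_of_tuple u, p.2 + tnorm u) = \int[lam]_s (- 1 * c u s).
  rewrite RintegralZl //.
  have H := @Rintegral_tail _ b (fun s => a (p.1, p.2 + s)) (tnorm u)
    (Num.max (t0 - p.2) (t1 - p.2) + 1) cb (fun s => time_is_derive p s csa).
  rewrite H => [|s sN]; first by rewrite /ker1 mul1r mulN1r opprK; exact: ca.
  have : Num.max (t0 - p.2) (t1 - p.2) < s by apply: lt_le_trans sN; rewrite ltrDl.
  by rewrite gt_max => /andP[h0 h1]; split; [apply: tt1|apply: at0] => /=; lra.
under eq_Rintegral do rewrite tailE.
pose S := [set u : m.-tuple RT | tnorm u <= M].
have mS : measurable S := measurable_tnorm_le M.
have iind (A : set (m.-tuple RT)) : measurable A -> (mu A < +oo)%E ->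
    mu.-integrable setT (EFin \o (\1_A : m.-tuple RT -> R)).
  move=> mA fA; apply/integrableP; split; first exact/measurable_EFinP.
  under eq_integral => u _ do rewrite gee0_abs ?lee_fin //.
  by rewrite integral_indic // setIT.
(* A nonzero value of [c u s] forces [|u| < s <= M], so the indicators of [|u| <= M] and
   [0 <= s <= M] form a product majorant. *)
rewrite (@Rintegral_exchange _ _ _ _ _ mu lam (fun z => - 1 * c z.1 z.2)
  (fun u => \1_S u) (fun s => C * \1_(`[0, M]%classic : set RT) s)) //.
- rewrite -[RHS]/(_ * _) -RintegralZl //; last first.
    have := superpose_integrable p (adm_pow m) (Cinf_continuous cst) pst.
    by apply: eq_integrable => // s _; rewrite /= /displace scale1r addr0.
  apply: eq_Rintegral => s _ /=.
  have ms : measurable [set u : m.-tuple RT | tnorm u < s] := measurable_tnorm_lt s.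
  transitivity (\int[mu]_u (- b s * \1_[set u | tnorm u < s] u)).
    apply: eq_Rintegral => u _; rewrite /c indicE mulN1r mulNr mulrC; congr (- (_ * (nat_of_bool _)%:R)).
    by apply/idP/idP => [h|]; [exact: mem_set|move=> /set_mem].
  have fin : (mu [set u | (tnorm u < s)%R] < +oo)%E := lebesgue_tuple_tnorm_fin s.
  have i1 := iind _ ms fin.
  rewrite RintegralZl // /Rintegral integral_indic // setIT /ker_pow.
  have [s0|s0] := ltP 0 s.
    by rewrite [X in fine X](lebesgue_tuple_tnorm_lt s0) /= mul1r /b; ring.
  (* For [s <= 0] the ball is empty, in accordance with [ker_pow], which is zero there. *)
  rewrite (_ : mkset _ = set0) ?measure0 /= ?mulr0 ?mul0r ?mulr0 //.
  by apply/seteqP; split=> // u /= us; have := eucl_norm_ge0 (row_of_tuple u); rewrite leNgt (lt_le_trans us).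
- by apply: measurable_funM.
- exact: iind (tnorm_le_fin M).
move=> u s; rewrite mulN1r normrN /= indicE; case: (boolP (u \in _)) => [_|]; first by rewrite mul1r.
rewrite notin_setE /= => /negP; rewrite -ltNge => Mu.
rewrite /c; have [us|_] := ltP (tnorm u) s; last by rewrite !mul0r normr0.
by rewrite mul1r mul0r /b -(addr0 p.1) Hz ?normr0 // (lt_trans Mu).
Qed.

Lemma box_flat a : flat a -> box a = pd None (pd None a).
Proof.
move=> [sa da ca]; rewrite boxE big1 ?scaler0 ?addr0 // => i _.
by rewrite da pd0.
Qed.

Lemma iter_box_flat n a : flat a -> iter n box a = iter (2 * n) (pd None) a.
Proof.
move=> fa; elim: n => [//|n IH]; rewrite iterS IH box_flat; last exact: flat_iter_pd.
by rewrite mulnS.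
Qed.

(** The space derivatives in [cone_scaling] vanish. This reduces [B1] to [B0], so that no integral
    of [1/|u|] has to be evaluated. *)
Lemma cone_inv_flat a : flat a ->
  (1 - m%:R) *: cone ker_inv a = cone ker1 (pd None a).
Proof.
move=> [sa da ca]; rewrite -cone_scaling // big1 ?add0r // => i _.
by rewrite da /cone superpose0.
Qed.

(** The volume comes from the layer cake formula [cone1_flat], the sign and the factorial from
    undoing [m + 1] time derivatives in [tail_integral_iter]. *)
Definition flat_factor : R := - @unit_ball_volume R m * ((-1) ^+ m.+1 * m`!%:R).

Lemma flat_factor_neq0 : flat_factor != 0.
Proof.
rewrite /flat_factor !mulf_eq0 oppr_eq0 signr_eq0 pnatr_eq0 (gtn_eqF (fact_gt0 m)) /= orbF.
by rewrite gt_eqF // unit_ball_volume_gt0.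
Qed.

Lemma cone1_iter_flat a : flat a -> cone ker1 (iter m (pd None) a) = flat_factor *: a.
Proof.
move=> fa; rewrite cone1_flat; last exact: flat_iter_pd.
by rewrite -iterS tail_integral_iter ?scalerA //; case: fa.
Qed.

(** Each of the two copies of [B1] costs a factor [1/(1 - m)] when it is replaced by [B0], and then
    contributes one [flat_factor]. *)
Definition radon_factor : R := (1 - m%:R) ^- 2 * flat_factor ^+ 2.

Lemma dim_factor_neq0 : 1 - m%:R != 0 :> R.
Proof. by rewrite subr_eq0 eq_sym (eqr_nat R m 1) gtn_eqF. Qed.

Lemma radon_square_flat a : flat a -> radon_square a = radon_factor *: a.
Proof.
move=> fa; have [sa da ca] := fa.
have st : past_smooth (pd None a) by ps.
have E : cone ker_inv (cone ker_inv a) =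
    (1 - m%:R) ^- 2 *: cone ker1 (cone ker1 (pd None (pd None a))).
  rewrite -cone_inv_flat; last exact: flat_pd.
  rewrite coneZ; try ps.
  rewrite cone_comm; try ps.
  rewrite -cone_inv_flat // coneZ; try ps.
  by rewrite !scalerA expr2 invfM mulrA mulfVK ?mulVf ?scale1r // dim_factor_neq0.
rewrite /radon_square E iter_boxZ; last by ps.
rewrite !iter_box_cone; try ps.
rewrite iter_box_flat; last by do 2 apply: flat_pd.
rewrite -[pd None (pd None a)]/(iter 2 (pd None) a) -iterD.
(* On flat functions [box^(m-1)] is [2(m-1)] time derivatives, and the passage from [B1] to [B0]
   adds two. Each [B0] absorbs exactly [m] of them; this balance fixes the exponent [m - 1] in
   [P]. *)
have -> : (2 * m.-1 + 2 = m + m)%N by rewrite addnC -mulnS prednK ?mul2n ?addnn // ltnW.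
rewrite iterD cone1_iter_flat; last exact: flat_iter_pd.
have sm : past_smooth (iter m (pd None) a) by have [] := flat_iter_pd m fa.
by rewrite coneZ ?cone1_iter_flat ?scalerA // -?mulrA //; ps.
Qed.

(** * Freezing the space variable, Hadamard's lemma, and the value of [P] *)

Definition ker_unit (s : RT) : R := \1_(`[0, 1]%classic : set RT) s.

Lemma measurable_ker_unit : measurable_fun setT ker_unit.
Proof. exact: measurable_indic. Qed.

Lemma integrable_ker_unit (A : set RT) : measurable A -> lam.-integrable A (EFin \o ker_unit).
Proof.
move=> mA; apply: (integrableS measurableT) => //.
apply: (@Rintegral_dom_integrable _ _ 1 1) => [|s]; first exact: measurable_ker_unit.
by rewrite /ker_unit mul1r ger0_norm.
Qed.

Lemma ker_unit_neq0 s : ker_unit s != 0 -> 0 <= s <= 1.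
Proof.
rewrite /ker_unit indicE; case: (boolP (s \in _)) => [|_]; last by rewrite eqxx.
by rewrite inE /= in_itv.
Qed.

Lemma measurable_delay0 (M : R) : measurable [set y : RT | (0 : R) <= M].
Proof. 
by have [h|h] := boolP (0 <= M); [rewrite (_ : mkset _ = setT)|rewrite (_ : mkset _ = set0)] => //;
  apply/seteqP; split=> // y; rewrite /= (negbTE h).
Qed.

Lemma adm_freeze (x0 : 'rV[R]_m) :
  admissible lam (fun=> 0) (fun=> x0) (fun=> 0) ker_unit.
Proof.
split => //; first exact: measurable_ker_unit.
- by move=> M; apply: integrable_ker_unit; exact: measurable_delay0.
- by move=> M; exists `|x0| => s _ _; rewrite normr0.
Qed.

(** The restriction to [x = x0] is written as an average, with dilation 0, over a parameter on which
    the integrand does not depend. Smoothness is then an instance of [past_smooth_superpose]. *)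
Definition freeze (x0 : 'rV[R]_m) w : spacetime -> R :=
  superpose lam (fun=> 0) (fun=> x0) (fun=> 0) ker_unit w.

Lemma Rintegral_unit (f : RT -> R) :
  \int[lam]_s (ker_unit s * f s) = \int[lam]_(s in `[0, 1]) f s.
Proof.
rewrite [RHS]Rintegral_mkcond; apply: eq_Rintegral => s _.
by rewrite /patch /ker_unit indicE; case: ifP => _; rewrite ?mul1r ?mul0r.
Qed.

Lemma freezeE x0 w p : freeze x0 w p = w (x0, p.2).
Proof.
rewrite /freeze /superpose Rintegral_unit.
under eq_Rintegral do rewrite /displace scale0r add0r addr0.
rewrite Rintegral_cst //= lebesgue_measure_itv /= lte_fin ltr01 /=.
by rewrite oppr0 addr0 mulr1.
Qed.

Lemma flat_freeze x0 w : past_smooth w -> flat (freeze x0 w).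
Proof.
move=> sw; split=> [|i|x y t]; first exact: past_smooth_superpose (adm_freeze x0) sw.
- rewrite /freeze pd_superpose //; last exact: adm_freeze.
  apply/funext => p; rewrite /superpose (_ : (fun y => _) = cst 0) ?Rintegral_cst ?mul0r //.
  by apply/funext => y; rewrite /= mulr0 mul0r.
by rewrite !freezeE.
Qed.

Lemma adm_segment (x0 : 'rV[R]_m) :
  admissible lam id (fun s => (1 - s) *: x0) (fun=> 0) ker_unit.
Proof.
split => //; first exact: measurable_ker_unit.
- move=> i; under eq_fun do rewrite mxE.
  by apply: measurable_funM => //; apply: measurable_funB.
- by move=> M; apply: integrable_ker_unit; exact: measurable_delay0.
- move=> M; exists (1 + `|x0|) => s /ker_unit_neq0 /andP[s0 s1] _.
  rewrite ger0_norm // normrZ ger0_norm ?subr_ge0 //; split.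
    by rewrite (le_trans s1) // lerDl.
  by rewrite (@le_trans _ _ `|x0|) // ?lerDr // ler_piMl // gerBl.
Qed.

(** Applied to [D_i w], this is the quotient of Hadamard's lemma. It is the superposition with a
    variable dilation [s], the factor that the chain rule brings out. *)
Definition segment_average (x0 : 'rV[R]_m) w : spacetime -> R :=
  superpose lam id (fun s => (1 - s) *: x0) (fun=> 0) ker_unit w.

(** The fundamental theorem of calculus along the segment from [(x0, t)] to [(x, t)]. *)
Lemma hadamard x0 w : past_smooth w -> w = freeze x0 w +
  \sum_i mulcoord (Some i) (x0 ord0 i) (segment_average x0 (pd (Some i) w)).
Proof.
move=> sw; have [csw pw] := sw.
have sp i : past_smooth (pd (Some i) w) by ps.
apply/funext => p; rewrite fctE fct_sumE freezeE.
pose gam (s : R) : spacetime := (s *: p.1 + (1 - s) *: x0, p.2 + 0).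
pose q i s := pd (Some i) w (gam s).
have cgam j (s : R) : is_derive s 1 (fun s => stcoord j (gam s))
    (if j is Some i then p.1 ord0 i - x0 ord0 i else 0).
  case: j => [i|] /=; last exact: is_derive_cst.
  rewrite (_ : (fun s => _) = fun s => x0 ord0 i + s * (p.1 ord0 i - x0 ord0 i)).
    exact: affine_is_derive.
  by apply/funext => l; rewrite !mxE; ring.
have dw (s : R) : is_derive s 1 (fun s => w (gam s))
    (\sum_i (p.1 ord0 i - x0 ord0 i) * q i s).
  apply: (is_derive_eq (chain_rule (Cinf_c1 csw) (cgam^~ s))).
  rewrite big_option mul0r add0r; apply: eq_bigr => i _.
  by rewrite /q pd.unlock.
have gamc : continuous gam.
  move=> s; have g1 : s *: p.1 + (1 - s) *: x0 @[s --> s] --> s *: p.1 + (1 - s) *: x0.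
    apply: cvgD; apply: cvgZr_tmp; first exact: cvg_id.
    by apply: cvgB; [exact: cvg_cst|exact: cvg_id].
  have g2 : p.2 + 0 @[_ --> s] --> p.2 + 0 by exact: cvg_cst.
  exact: (cvg_pair g1 g2).
have cq i : continuous (q i).
  move=> s; apply: (@continuous_comp _ _ _ gam (pd (Some i) w) s (gamc s)).
  by have [/Cinf_continuous + _] := sp i; exact.
have cQ : continuous (fun s => \sum_i (p.1 ord0 i - x0 ord0 i) * q i s).
  move=> s; apply: cvg_rsum => i.
  by apply: cvgM; [exact: cvg_cst|exact: cq].
have := Rintegral_FTC2 ltr01 cQ dw; rewrite -Rintegral_unit.
have -> : w (gam 1) = w p by rewrite /gam scale1r subrr scale0r !addr0; case: (p).
have -> : w (gam 0) = w (x0, p.2) by rewrite /gam scale0r add0r subr0 scale1r addr0.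
move=> E; apply/eqP; rewrite addrC -subr_eq -E; apply/eqP.
have iq i : lam.-integrable setT (EFin \o (fun s => ker_unit s * ((p.1 ord0 i - x0 ord0 i) * q i s))).
  have [/Cinf_continuous ci pi] := sp i.
  have := superpose_integrable p (adm_segment x0) ci pi.
  move=> /(integrableZl measurableT (p.1 ord0 i - x0 ord0 i)); apply: eq_integrable => // s _.
  by rewrite /= -EFinM mulrCA.
under eq_Rintegral do rewrite mulr_sumr.
rewrite (Rintegral_sum _ iq).2; apply: eq_bigr => i _.
rewrite /mulcoord /segment_average /superpose /= -RintegralZl //; last first.
  by have [/Cinf_continuous ci pi] := sp i; exact: (superpose_integrable p (adm_segment x0) ci pi).
by apply: eq_Rintegral => s _; rewrite mulrCA.
Qed.

Lemma radon_squareE w : past_smooth w -> radon_square w = radon_factor *: w.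
Proof.
move=> sw; apply/funext => -[x t].
have sh i : past_smooth (segment_average x (pd (Some i) w)).
  by apply: past_smooth_superpose; [exact: adm_segment|ps].
have fw := flat_freeze x sw; have [sf _ _] := fw.
(* The function is frozen at the very point of evaluation: after the factors [x_i - c] are moved out
   of [P], they vanish there. *)
rewrite {1}(hadamard x sw) radon_squareD //; last first.
  by apply: past_smooth_sum => i; ps.
rewrite radon_square_sum; last by move=> i; ps.
rewrite radon_square_flat // !fctE freezeE fct_sumE big1 ?addr0 // => i _.
by rewrite radon_square_mulcoord // /mulcoord /= subrr mul0r.
Qed.

(** One [box] is spent on turning [B0] into [(1 - m) B1 D_t]; the others make up [P] applied to
    [D_t w]. *)
Lemma iter_box_cone_cone w : past_smooth w ->
  iter m box (cone ker_inv (cone ker1 w)) = ((1 - m%:R) * radon_factor) *: pd None w.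
Proof.
move=> sw; have sb : past_smooth (cone ker1 w) by ps.
have -> : iter m box (cone ker_inv (cone ker1 w)) =
    iter m.-1 box (box (cone ker_inv (cone ker1 w))).
  by rewrite -iterSr prednK // ltnW.
rewrite box_cone // box_cone1 // coneZ; try ps.
rewrite iter_boxZ; last by ps.
by rewrite -/(radon_square _) radon_squareE ?scalerA //; ps.
Qed.

Lemma radon_factor_neq0 : radon_factor != 0.
Proof.
by rewrite /radon_factor mulf_neq0 ?invr_eq0 ?expf_neq0 ?dim_factor_neq0 // flat_factor_neq0.
Qed.

End cone_box.

(** * Range of the conical Radon transform *)

Section range.
Context {R : realType} {m : nat} (m1 : (1 < m)%N).
Local Notation RT := (measurableTypeR R).
Local Notation lam := (@lebesgue_measure R).
Local Notation spacetime := ('rV[R]_m * R)%type.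
Implicit Types (f g h w : spacetime -> R) (p q : spacetime).

Lemma conicalE f : conical f = cone ker1 f.
Proof. by apply/funext => p; rewrite coneE; apply: eq_Rintegral => u _; rewrite /ker1 mul1r. Qed.

Lemma conical1E f : past_smooth f -> conical1 f = (Num.sqrt 2)^-1 *: cone ker_inv f.
Proof.
move=> [sf pf]; apply/funext => p; rewrite fctE coneE.
have i := cone_integrable p (adm_inv m1) (Cinf_continuous sf) pf.
rewrite -[RHS]/(_ * _) -RintegralZl //; apply: eq_Rintegral => u _.
by rewrite invfM mulrC /ker_inv mulrA.
Qed.

Lemma supp_past f t0 : supp f `<=` past t0 <-> forall p, t0 < p.2 -> f p = 0.
Proof.
split=> [sft p pt|ft].
  apply/eqP; apply: contraTT pt => fp; rewrite -leNgt.
  by apply: (sft p); exact: subset_closure.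
have cl : closed (past t0 : set spacetime).
  by apply: (@preimage_closed _ _ snd [set t : R | t <= t0]) => [p _|]; [exact: cvg_snd|exact: closed_le].
rewrite /supp (_ : past t0 = closure (past t0)); last exact/closure_id.
by apply: closureS => p /= /eqP fp; rewrite /past /= leNgt; apply/negP => /ft.
Qed.

Definition bounded_supported f := exists B : R, forall p, B < `|p| -> f p = 0.

Lemma compactly_supportedP f : compactly_supported f <-> bounded_supported f.
Proof.
split=> [/compact_bounded[M [_ HM]]|[B fB]].
  exists (M + 1) => p Mp; apply/eqP; apply: contraTT Mp => fp; rewrite -leNgt.
  by apply: (HM (M + 1)); [rewrite ltrDl|exact: subset_closure].
have cB : compact [set q : spacetime | `|q| <= B] := @compact_norm_le R m B.
apply: (subclosed_compact _ cB); first exact: closed_closure.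
have clB : closed [set q : spacetime | `|q| <= B].
  by apply: compact_closed cB; exact: norm_hausdorff.
rewrite ((closure_id _).1 clB); apply: closureS => p /= /eqP fp.
by rewrite leNgt; apply/negP => /fB.
Qed.

Lemma bounded_past_supported f : bounded_supported f -> past_supported f.
Proof.
move=> [B fB]; exists B => p Bp; apply: fB.
by rewrite (lt_le_trans Bp) // (le_trans (ler_norm _)) // (stcoord_norm None p).
Qed.

Lemma bounded_supportedZ (c : R) f : bounded_supported f -> bounded_supported (c *: f).
Proof. by move=> [B fB]; exists B => p /fB fp; rewrite fctE fp scaler0. Qed.

Lemma bounded_supported_pd j f : bounded_supported f -> bounded_supported (pd j f).
Proof.
move=> [B fB]; exists B => p Bp; rewrite pdE -[RHS](derive_cst (0 : R) p (axis j)).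
apply: near_eq_derive.
have : \forall q \near p, B < `|q| by exact: (cvgr_gt `|p| (@norm_continuous _ _ p)).
by apply: filterS => q; exact: fB.
Qed.

Lemma Rintegral_pd_time f x : Cinf f -> bounded_supported f ->
  \int[lam]_t pd None f (x, t) = 0.
Proof.
move=> sf bf; have [B fB] := bf; have [B' tB] := bounded_supported_pd None bf.
(* Both [f] and its time derivative vanish for [|t| >= M], so the tail integral from [- M] is the
   integral over the whole line. *)
pose M := `|Num.max B B'| + 1.
have M0 : 0 <= M by rewrite addr_ge0.
have far (s : R) : M <= `|s| -> f (x, s) = 0 /\ pd None f (x, s) = 0.
  move=> Ms; have : Num.max B B' < `|s|.
    by apply: lt_le_trans Ms; rewrite (le_lt_trans (ler_norm _)) // ltrDl.
  rewrite gt_max => /andP[Bs B's]; have le : `|s| <= `|(x, s)| := stcoord_norm None (x, s).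
  by split; [apply: fB|apply: tB]; exact: lt_le_trans le.
have E := @Rintegral_tail _ (fun s => pd None f (x, 0 + s)) (fun s => f (x, 0 + s)) (- M) M
  (@time_continuous _ _ _ (x, 0) (Cinf_continuous (Cinf_pd None sf)))
  (fun s => @time_is_derive _ _ f (x, 0) s sf).
transitivity (- f (x, 0 + - M)); last first.
  by rewrite add0r; have [|-> _] := far (- M); rewrite ?oppr0 // normrN ger0_norm.
rewrite -E => [|s Ms]; last first.
  by have := far s; rewrite add0r ger0_norm ?(le_trans M0) //; case.
have low (s : R) : s <= - M -> M <= `|s|.
  by move=> sM; have := ler_norm (- s); rewrite normrN; apply: le_trans; rewrite lerNr.
apply: eq_Rintegral => s _; rewrite add0r; have [_|/low sM] := ltP (- M) s; first by rewrite mul1r.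
by have [//|_ ->] := far s; rewrite mulr0.
Qed.

(** For [x] far out or [t] late the integrand vanishes on the whole tail. For [t] early the tail
    integral is the full time integral, which is zero by assumption; this is the use of condition
    (ii). *)
Lemma tail_integral_bounded h : past_smooth h -> bounded_supported h ->
  (forall x, \int[lam]_t h (x, t) = 0) -> bounded_supported (tail_integral 0 h).
Proof.
move=> sh [B hB] h0; have [csh _] := sh.
pose F : spacetime -> R := -1 *: tail_integral 0 h.
have [cF _] : past_smooth F by apply: past_smoothZ; exact: past_smooth_tail.
have dF : pd None F = h.
  rewrite pdZ; last by have [] := past_smooth_tail 0 sh.
  by rewrite pd_tail // tail_integral0_dt // scaleN1r opprK.
have zero p : (forall s, 0 < s -> h (p.1, p.2 + s) = 0) -> tail_integral 0 h p = 0.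
  move=> hz; rewrite tail_integralE.
  rewrite (_ : (fun s => _) = fun=> 0) ?Rintegral_cst ?mul0r //.
  apply/funext => s; rewrite /ker_pow; have [s0|] := ltP 0 s; last by rewrite !mul0r.
  by rewrite hz // mulr0.
have far x (s : R) : `|B| < `|s| -> h (x, s) = 0.
  move=> Bs; apply: hB; apply: (le_lt_trans (ler_norm B)); apply: lt_le_trans Bs _.
  exact: (stcoord_norm None (x, s)).
have high x (s : R) : `|B| < s -> tail_integral 0 h (x, s) = 0.
  move=> Bs; apply: zero => r r0; apply: far.
  by rewrite (lt_le_trans Bs) // (le_trans _ (ler_norm _)) // lerDl ltW.
exists `|B| => p Bp; have [p1B|p1B] := ltP `|B| `|p.1|.
  apply: zero => s _; apply: hB; apply: (le_lt_trans (ler_norm B)); apply: (lt_le_trans p1B).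
  by have := lexx `|(p.1, p.2 + s)|; rewrite {1}norm_le => /andP[].
have p2B : `|B| < `|p.2|.
  by rewrite ltNge; apply/negP => p2B; move: Bp; rewrite ltNge norm_le p1B p2B.
have [p20|p20] := ltP 0 p.2.
  by rewrite (surjective_pairing p) high // -(gtr0_norm p20).
have E := @Rintegral_tail _ (fun s => pd None F (p.1, 0 + s)) (fun s => F (p.1, 0 + s)) p.2 (`|B| + 1)
  (@time_continuous _ _ _ (p.1, 0) (Cinf_continuous (Cinf_pd None cF)))
  (fun s => @time_is_derive _ _ F (p.1, 0) s cF).
transitivity (- F (p.1, 0 + p.2)).
  by rewrite add0r /F fctE scaleN1r opprK -surjective_pairing.
rewrite -E => [|s Bs]; last first.
  have {}Bs : `|B| < s by rewrite (lt_le_trans _ Bs) // ltrDl.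
  by rewrite dF /F fctE add0r high // scaler0 far // (lt_le_trans Bs) // ler_norm.
rewrite dF -[RHS](h0 p.1); apply: eq_Rintegral => s _; rewrite add0r.
have [_|sp] := ltP p.2 s; first by rewrite mul1r.
rewrite mul0r far // (lt_le_trans p2B) // !ler0_norm ?lerN2 //.
exact: le_trans p20.
Qed.

Lemma conical_range g : smooth g ->
  (exists f, [/\ smooth f, compactly_supported f & g = conical f]) <->
  [/\ compactly_supported (iter m dalembertian (conical1 g)),
      forall x, \int[lam]_(t in [set: R]) iter m dalembertian (conical1 g) (x, t) = 0
    & exists t0 : R, supp g `<=` past t0].
Proof.
have -> : @dalembertian R m = box by rewrite box.unlock.
have -> : @smooth R m = Cinf by rewrite Cinf.unlock.
move=> sg; set r2 := (Num.sqrt 2)^-1 : R.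
have r20 : r2 != 0 by rewrite invr_eq0 gt_eqF // sqrtr_gt0.
pose c : R := (1 - m%:R) * @radon_factor R m.
have c0 : c != 0 by rewrite mulf_neq0 ?dim_factor_neq0 ?radon_factor_neq0.
have cE w : past_smooth w -> iter m box (cone ker_inv (cone ker1 w)) = c *: pd None w.
  exact: iter_box_cone_cone.
have hE w : past_smooth w -> iter m box (conical1 w) = r2 *: iter m box (cone ker_inv w).
  by move=> sw; rewrite conical1E // iter_boxZ //; apply: past_smooth_cone => //; exact: adm_inv.
split=> [[f [sf cf gE]]|[ch ih [t0 gt0]]].
  have bf := (compactly_supportedP f).1 cf.
  have pf : past_smooth f by split=> //; exact: bounded_past_supported.
  have pg : past_smooth g by rewrite gE conicalE; apply: past_smooth_cone => //; exact: adm1.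
  rewrite hE // {1 2}gE conicalE cE // scalerA; split.
  - by apply/compactly_supportedP; apply: bounded_supportedZ; exact: bounded_supported_pd.
  - move=> x; rewrite -pdZ //; apply: Rintegral_pd_time; first exact: CinfZ.
    exact: bounded_supportedZ.
  - by have [_ [t0 gt0]] := pg; exists t0; apply/supp_past.
have pg : past_smooth g by split=> //; exists t0; exact/supp_past.
pose h := iter m box (cone ker_inv g).
have sh : past_smooth h by apply: past_smooth_iter_box; apply: past_smooth_cone => //; exact: adm_inv.
rewrite hE // -/h in ch ih.
have bh : bounded_supported (r2 *: h) by apply/compactly_supportedP.
have sr : past_smooth (r2 *: h) by exact: past_smoothZ.
(* The factor [r2] stays inside since (i) and (ii) concern [r2 *: h]. The minus sign undoes that of
   [tail_integral0_dt], and the constant is chosen to give [c D_t f = h]. *)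
pose f := - (c * r2)^-1 *: tail_integral 0 (r2 *: h).
have sf : past_smooth f by apply: past_smoothZ; exact: past_smooth_tail.
have df : c *: pd None f = h.
  rewrite pdZ; last by have [] := past_smooth_tail 0 sr.
  rewrite pd_tail // tail_integral0_dt // scalerN -scaleNr opprK !scalerA.
  by rewrite -mulrA -[_ * r2]mulrC mulrA divff ?scale1r // mulf_neq0.
have bf : bounded_supported f by apply: bounded_supportedZ; exact: tail_integral_bounded.
clearbody f.
exists f; split; [by case: sf|exact/compactly_supportedP|].
rewrite conicalE; have sB : past_smooth (cone ker1 f) by apply: past_smooth_cone => //; exact: adm1.
pose w := cone ker1 f + -1 *: g.
have sw : past_smooth w by apply: past_smoothD => //; exact: past_smoothZ.
have a1 := @adm1 R m; have ai := adm_inv (R := R) m1.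
have w0 : iter m box (cone ker_inv w) = 0.
  rewrite /w coneD // ?coneZ //; last exact: past_smoothZ.
  have sBf : past_smooth (cone ker_inv (cone ker1 f)) by exact: past_smooth_cone.
  have sBg : past_smooth (cone ker_inv g) by exact: past_smooth_cone.
  rewrite iter_boxD //; last exact: past_smoothZ.
  by rewrite iter_boxZ // cE // df -/h scaleN1r subrr.
have dw : pd None w = 0.
  have := cE w sw; rewrite cone_comm // iter_box_cone // ?w0; last exact: past_smooth_cone.
  by rewrite /cone superpose0 => /esym/eqP; rewrite scaler_eq0 (negbTE c0) => /eqP.
have := dt_inj sw dw; rewrite /w scaleN1r => /eqP; rewrite subr_eq0 => /eqP ->.
by [].
Qed.

End range.

Theorem theorem2 (R : realType) (k : nat) (hk : (1 <= k)%N)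
    (g : 'rV[R]_(2 * k) * R -> R) (hg : smooth g) :
  (exists f : 'rV[R]_(2 * k) * R -> R,
     [/\ smooth f, compactly_supported f & g = conical f]) <->
  [/\ compactly_supported (iter (2 * k) dalembertian (conical1 g)),
      forall x : 'rV[R]_(2 * k),
        \int[lebesgue_measure]_(t in [set: R])
          iter (2 * k) dalembertian (conical1 g) (x, t) = 0
    & exists t0 : R, supp g `<=` past t0].
Proof.
apply: conical_range => //.
by rewrite mul2n -addnn (leq_add hk hk).
Qed.
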